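(* Consider an adaptive MCMC algorithm with kernels $(P_\theta)_{\theta\in\Theta}$, defining a Markov chain $(X_t,\theta_t,\psi_t)_{t\in\mathbb{N}}$ on $\mathcal{X}\times\Theta\times\Psi$ and targeting a probability distribution $\pi$. Suppose that the following three conditions hold: (i) for all $\delta>0$ there exists a compact set $C_\delta\subset\mathcal{X}\times\Theta$ such that $\Pr((X_t,\theta_t)\in C_\delta)\ge 1-\delta$ for all $t\in\mathbb{N}$; (ii) the random variable $d_\Theta(\theta_{t+1},\theta_t)$ converges to $0$ in probability as $t\to\infty$; (iii) for every $\theta\in\Theta$ the kernel $P_\theta$ is ergodic relatively to $\pi$, i.e. $\lim_{t\to\infty}\|P_\theta^t(x,\cdot)-\pi\|=0$ for all $x\in\mathcal{X}$. Suppose furthermore that at least one of the following two sets of conditions holds: (I) for every integer $t\ge 1$ the functions $(x,\theta,y)\mapsto\tilde p^t_\theta(x,y)$ and $(x,\theta)\mapsto\tilde P^t_\theta(x,\mathcal{X})$ are continuous; and there exist a countable set $I$ and continuous functions $b_i:\mathcal{X}\times\Theta\to[0,\infty)$ and $s_i:\mathcal{X}\to\mathcal{X}$ ($i\in I$) such that $B_\theta(x,\cdot)=\sum_{i\in I}b_i(x,\theta)\delta_{s_i(x)}$ for all $(x,\theta)\in\mathcal{X}\times\Theta$; (II) the functions $(x,\theta,y)\mapsto\tilde p_\theta(x,y)$ and $(x,\theta)\mapsto\tilde P_\theta(x,\mathcal{X})$ are continuous; for any $(\theta_0,y_0)\in\Theta\times\mathcal{X}$ there exist a neighbourhood $U$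 of $(\theta_0,y_0)$ and $M$ such that $\tilde p_\theta(x,y)<M$ for all $x\in\mathcal{X}$ and all $(\theta,y)\in U$; and there exist a countable set $I$ and continuous functions $b_i:\mathcal{X}\times\Theta\to[0,\infty)$ and $s_i:\mathcal{X}\to\mathcal{X}$ ($i\in I$) such that $B_\theta(x,\cdot)=\sum_{i\in I}b_i(x,\theta)\delta_{s_i(x)}$ for all $(x,\theta)$ and each $s_i$ is either constant (equal to some $a_i\in\mathcal{X}$) or the identity $s_i(x)=x$. Then the adaptive MCMC is ergodic relatively to $\pi$: for any initial condition $(x_0,\theta_0,\psi_0)\in\mathcal{X}\times\Theta\times\Psi$, $$\lim_{t\to\infty}\left\|\Pr\left(X_t\in\cdot\mid X_0=x_0,\theta_0=\theta_0,\psi_0=\psi_0\right)-\pi\right\|=0 ,$$ where the conditioning means that the chain is started at the point $(x_0,\theta_0,\psi_0)$.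
   Context: The state space $\mathcal{X}$ is a metric space with distance $d_{\mathcal{X}}$, sigma-algebra $\Sigma$ and measure $\lambda$. The target $\pi$ is a probability distribution on $\mathcal{X}$, absolutely continuous with respect to $\lambda$ with density $g_\pi$. The parameter space $\Theta$ and adaptation space $\Psi$ are measurable spaces, and $\Theta$ carries a distance $d_\Theta$. For a signed measure $\nu$ on $\Sigma$, $\|\nu\|:=\sup_{A\in\Sigma}|\nu(A)|$. $\delta_z$ denotes the Dirac measure at $z$. For each $\theta\in\Theta$, $P_\theta$ is a Markov kernel on $\mathcal{X}$ and $P_\theta^t$ is its $t$-step iterate. By Lebesgue decomposition with respect to $\lambda$, for every $t\ge1$, $P^t_\theta(x,\cdot)=\tilde P^t_\theta(x,\cdot)+B^t_\theta(x,\cdot)$ with $\tilde P^t_\theta(x,\cdot)$ absolutely continuous with density $\tilde p^t_\theta(x,\cdot)$ and $B^t_\theta(x,\cdot)$ singular (here the superscript $t$ on $\tilde P,\tilde p,B$ refers to the parts of $P^t_\theta$); for $t=1$ the superscript is dropped. An adaptive MCMC with kernels $(P_\theta)_\theta$ is a time-homogeneous Markov chain $(X_t,\theta_t,\psi_t)_{t\in\mathbb{N}}$ on $\mathcal{X}\times\Theta\times\Psi$ in which, conditionally on the history up to time $t$, $X_{t+1}$ has law $P_{\theta_t}(X_t,\cdot)$; $\psi_t$ contains auxiliary variables of the adaptation. In conditions (i) and (ii), $\Pr$ is the law of the chain started from a given initial condition $(x_0,\theta_0,\psi_0)$, and the conditions are required for every initial condition (the compact sets may depend on it). *)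

(* Defs.v *)
(* MathComp-Analysis, over an arbitrary R : realType. *)
From HB Require Import structures.
From mathcomp Require Import all_boot all_order all_algebra.
From mathcomp Require Import all_classical all_reals all_analysis.

Set Implicit Arguments.
Unset Strict Implicit.
Unset Printing Implicit Defensive.

Import Order.TTheory GRing.Theory Num.Theory.
Import numFieldNormedType.Exports.

Local Open Scope classical_set_scope.
Local Open Scope ring_scope.
Local Open Scope ereal_scope.

(* No compatibility between the sigma-algebra and the metric topology is
   imposed: the Borel sigma-algebra is a special case. *)
#[short(type="metricMeasurableType")]
HB.structure Definition MetricMeasurable (d : measure_display)
    (R : numDomainType) :=
  { T of Measurable d T & Metric R T }.

(* This is sup_A |nu A|, not the total variation |nu|(T); for a difference of
   two probabilities it is half of the latter. *)
Definition tv_norm d (T : measurableType d) (R : realType)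
    (nu : set T -> \bar R) : \bar R :=
  ereal_sup [set `|nu A| | A in measurable].

Fixpoint kernel_iter d (T : measurableType d) (R : realType)
    (k : R.-pker T ~> T) (t : nat) (x : T) (A : set T) : \bar R :=
  match t with
  | 0%N => \d_x A
  | t'.+1 => \int[k x]_y kernel_iter k t' y A
  end.

Section lebesgue_decomposition.
Context d (T : measurableType d) (R : realType).
Implicit Types (lambda nu_ac nu_s : {measure set T -> \bar R}).

Definition has_density lambda (nu : set T -> \bar R) (g : T -> R) : Prop :=
  [/\ measurable_fun setT g,
      forall x, (0 <= g x)%R &
      forall A, measurable A -> nu A = \int[lambda]_(x in A) (g x)%:E].

Definition singular_to lambda nu_s : Prop :=
  exists N, [/\ measurable N, lambda N = 0 & nu_s (~` N) = 0].

Definition lebesgue_decomposition lambda (nu : set T -> \bar R)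
    nu_ac nu_s : Prop :=
  [/\ forall A, measurable A -> nu A = nu_ac A + nu_s A,
      nu_ac `<< lambda & singular_to lambda nu_s].

End lebesgue_decomposition.

Section markov_chain.
Context dS dO (S : measurableType dS) (Omega : measurableType dO)
  (R : realType).

Definition history (Z : nat -> Omega -> S) (t : nat) : set (set Omega) :=
  <<s \bigcup_(k in [set k | (k <= t)%N])
        preimage_set_system setT (Z k) measurable >>.

(* Time-homogeneous Markov family: under Pr z the process Z starts at z, and
   the conditional law of Z (t+1) given the history up to time t is Q (Z t),
   the conditional law being expressed by integration over history events. *)
Definition markov_chain (Q : R.-pker S ~> S) (Pr : S -> probability Omega R)
    (Z : nat -> Omega -> S) : Prop :=
  [/\ forall t, measurable_fun setT (Z t),
      forall z A, measurable A -> Pr z (Z 0%N @^-1` A) = \d_z A &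
      forall z t H A, history Z t H -> measurable A ->
        Pr z (H `&` Z t.+1 @^-1` A) = \int[Pr z]_(w in H) Q (Z t w) A].

End markov_chain.

(* Since every (x, theta, psi) is a possible initial condition, the requirement
   that X (t+1) has law P_(theta t) (X t) given the history says that the
   X-marginal of the transition kernel Q at (x, theta, psi) is P_theta x. *)
Definition adaptive_mcmc dX dT dP dO (X : measurableType dX)
    (Theta : measurableType dT) (Psi : measurableType dP)
    (Omega : measurableType dO) (R : realType)
    (P : Theta -> R.-pker X ~> X)
    (Q : R.-pker (X * Theta * Psi)%type ~> (X * Theta * Psi)%type)
    (Pr : X * Theta * Psi -> probability Omega R)
    (X_ : nat -> Omega -> X) (theta_ : nat -> Omega -> Theta)
    (psi_ : nat -> Omega -> Psi) : Prop :=
  markov_chain Q Pr (fun t w => (X_ t w, theta_ t w, psi_ t w)) /\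
  forall x theta psi A, measurable A ->
    Q (x, theta, psi) [set z | A z.1.1] = P theta x A.

(* Convergence to 0, for random variables. *)
Definition cvg0_in_probability d (Omega : measurableType d) (R : realType)
    (Pr : probability Omega R) (Y : nat -> Omega -> R) : Prop :=
  (forall t, measurable_fun setT (Y t)) /\
  forall eps : R, (0 < eps)%R ->
    Pr [set w | (eps < `|Y t w|)%R] @[t --> \oo] --> 0.

Definition atomic_decomposition dX dT (R : realType)
    (X : metricMeasurableType dX R) (Theta : metricMeasurableType dT R)
    (B : Theta -> X -> {measure set X -> \bar R})
    (I : countType) (b : I -> X * Theta -> R) (s : I -> X -> X) : Prop :=
  [/\ forall i xth, (0 <= b i xth)%R,
      forall i, continuous (b i),
      forall i, continuous (s i) &
      forall x theta A, measurable A ->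
        B theta x A = \esum_(i in [set: I]) ((b i (x, theta))%:E * \d_(s i x) A)].

(* Main.v *)
(* Two facts about the kernels drive the proof. On a compact set of pairs
   (x, theta) the convergence of P_theta^n(x, .) to pi is uniform, because the
   distance is nonincreasing in n and each pair has a neighbourhood on which
   some iterate is already close to pi; and theta' |-> P_theta'(x, .) is
   equicontinuous in total variation. Hence, starting at a late time t from a
   compact set, N steps of the chain are close in law to N steps of the frozen
   kernel P_(theta t): replacing the frozen kernel by the current one, one step
   at a time, costs little since the parameter drifts by a small amount.

   All comparisons are one-sided, mu A <= nu A + e for every measurable A: for
   measures of equal mass, taking complements gives the other side. For the
   same reason only a lower bound on densities and weights is ever needed, and
   dominated convergence (a Scheffe argument) provides it without any
   compatibility between the topology and the sigma-algebra.

   In case (I) the neighbourhoods come from the density of P_theta^t. In case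
   (II) the only part of P_theta(x, .) that is not continuous in total variation
   is the mass kept at x, which contributes at most stay(x, theta)^t after t
   steps; since x then lies in a lambda-null set, stay^t is bounded by the
   distance of P_theta^t(x, .) to pi. *)
Require Import Defs.
From HB Require Import structures.
From mathcomp Require Import all_boot all_order all_algebra.
From mathcomp Require Import all_classical all_reals all_analysis.
From mathcomp Require Import measurable_realfun lra.
Set Implicit Arguments.
Unset Strict Implicit.
Unset Printing Implicit Defensive.

Import Order.TTheory GRing.Theory Num.Theory.
Import numFieldNormedType.Exports.

Local Open Scope classical_set_scope.
Local Open Scope ring_scope.
Local Open Scope ereal_scope.

(** * Integration of one-sided comparisons *)

(** With [r] the positive part in the Hahn decomposition of the charge [mu - nu], [mu <= nu + r] and
    [r] has total mass at most [e]; then [h <= 1] bounds the integral of [h] against [r]. *)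
Lemma le_integral_approx_measure d (T : measurableType d) (R : realType)
    (mu nu : {measure set T -> \bar R}) (e : R) (h : T -> \bar R) :
  mu setT < +oo -> nu setT < +oo ->
  (forall A, measurable A -> mu A <= nu A + e%:E) ->
  measurable_fun setT h -> (forall x, 0 <= h x <= 1) ->
  \int[mu]_x h x <= \int[nu]_x h x + e%:E.
Proof.
move=> muoo nuoo munu mh h01.
have h0 x : 0 <= h x by have /andP[] := h01 x.
have h1 x : h x <= 1 by have /andP[] := h01 x.
have fin (m : {measure set T -> \bar R}) : m setT < +oo -> fin_num_fun m.
  move=> moo A mA; rewrite ge0_fin_numE//.
  by rewrite (le_lt_trans _ moo)// le_measure// inE.
have [muf nuf] := (fin _ muoo, fin _ nuoo).
(* The charge is built from finite measures, so [mu] and [nu] are first repackaged as such. *)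
have pack (m : {measure set T -> \bar R}) : fin_num_fun m ->
    exists m' : {finite_measure set T -> \bar R}, m' = m :> (set T -> \bar R).
  move=> mfin.
  pose H1 := isFinite.Build _ _ _ m mfin.
  have sf : sigma_finite setT m.
    by apply: fin_num_fun_sigma_finite => //; rewrite measure0.
  pose H2 := isSFinite.Build _ _ _ m (sfinite_measure_sigma_finite sf).
  pose H3 := isSigmaFinite.Build _ _ _ m sf.
  by exists (HB.pack_for (FiniteMeasure.type T R) (Measure.sort m) H1 H2 H3).
have [m1 m1E] := pack _ muf; have [m2 m2E] := pack _ nuf.
pose c : {charge set T -> \bar R} := cadd (charge_of_finite_measure m1)
  (copp (charge_of_finite_measure m2)).
have cE A : c A = mu A - nu A by rewrite /c /cadd /copp/= -m1E -m2E.
have [P [N PN]] := Hahn_decomposition c.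
have [[mP posP] [mN negN] PNT PN0] := PN.
pose r := jordan_pos PN.
have rE A : measurable A -> r A = c (A `&` P).
  by move=> mA; rewrite /r jordan_posE cjordan_posE /crestr0 mem_set.
have le_mu A : measurable A -> mu A <= measure_add nu r A.
  move=> mA; rewrite measure_addE addeC -leeBlDr ?nuf//.
  rewrite -cE (jordan_decomp PN mA) -/r.
  rewrite /cadd/= /cscale/= mulN1e geeDl// oppe_le0.
  exact: (measure_ge0 (jordan_neg PN)).
have rT : r setT <= e%:E.
  rewrite rE// setTI cE leeBlDr ?nuf// addeC; exact: munu.
apply: (le_trans (ge0_le_measure_integral le_mu measurableT h0 mh)).
rewrite ge0_integral_measure_add//.
apply: leeD => //; apply: (le_trans _ rT).
apply: (@le_trans _ _ (\int[r]_x cst 1 x)).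
  by apply: ge0_le_integral => //.
by rewrite integral_cst// mul1e.
Qed.

(** * Iterates of a probability kernel *)

Section kernel_iterates.
Context d (T : measurableType d) (R : realType) (k : R.-pker T ~> T).

Section comp_snd.
Variable l : R.-pker T ~> T.

(** [mkcomp] composes with a kernel that may depend on both the source and the intermediate point;
    this one ignores the source. *)
Definition kcomp_snd_kernel : T * T -> {measure set T -> \bar R} :=
  fun xy => l xy.2.

Let measurable_kcomp_snd_kernel U :
  measurable U -> measurable_fun setT (kcomp_snd_kernel ^~ U).
Proof.
move=> mU; exact: (measurableT_comp (measurable_kernel l U mU) measurable_snd).
Qed.

HB.instance Definition _ := isKernel.Build _ _ _ _ R kcomp_snd_kernel
  measurable_kcomp_snd_kernel.

Let kcomp_snd_kernel_setT x : kcomp_snd_kernel x setT = 1.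
Proof. exact: prob_kernel. Qed.

HB.instance Definition _ := Kernel_isProbability.Build _ _ _ _ R
  kcomp_snd_kernel kcomp_snd_kernel_setT.

Definition kcomp_pker : T -> {measure set T -> \bar R} :=
  mkcomp k kcomp_snd_kernel.

HB.instance Definition _ := Kernel.on kcomp_pker.

Let kcomp_pker_setT x : kcomp_pker x setT = 1.
Proof.
rewrite /kcomp_pker/= /kcomp/= (eq_integral (cst 1)).
  by rewrite integral_cst// mul1e prob_kernel.
by move=> y _; exact: prob_kernel.
Qed.

HB.instance Definition _ := Kernel_isProbability.Build _ _ _ _ R
  kcomp_pker kcomp_pker_setT.
End comp_snd.

(** The iterates [kernel_iter] again, bundled as probability kernels so that measurability in the
    state and unit mass are inferred. *)
Fixpoint kpow (t : nat) : R.-pker T ~> T :=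
  if t is t'.+1 then kcomp_pker (kpow t')
  else kdirac (@measurable_id _ T setT).

Lemma kernel_iterE t x A : kernel_iter k t x A = kpow t x A.
Proof.
elim: t x A => [//|t ih] x A /=.
by apply: eq_integral => y _; rewrite ih.
Qed.

Lemma integral_kpowS t x h : measurable_fun setT h -> (forall y, 0 <= h y) ->
  \int[kpow t.+1 x]_y h y = \int[k x]_z \int[kpow t z]_y h y.
Proof.
move=> mh h0.
exact: (integral_kcomp k (kcomp_snd_kernel (kpow t)) x h0 mh).
Qed.

(** The recursion of [kpow] splits off the first step; splitting off the last one allows a step to
    be appended to a comparison of laws. *)
Lemma kpowSr t x A : measurable A -> kpow t.+1 x A = \int[kpow t x]_y k y A.
Proof.
move=> mA; have mkA : measurable_fun setT (k ^~ A) by exact: measurable_kernel.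
elim: t x => [|t ih] x.
  rewrite [RHS](integral_dirac _ measurableT)// diracT mul1e.
  transitivity (\int[k x]_y (\1_A y)%:E); last by rewrite integral_indic ?setIT.
  by apply: eq_integral.
rewrite integral_kpowS//.
by apply: eq_integral => y _; rewrite -ih.
Qed.

End kernel_iterates.

(** * Continuity from below of densities and weights *)

(** The balls of radius [1 / (n + 1)] form a countable base at [p], so failure of [Q] near [p] gives
    a sequence tending to [p] along which [Q] always fails. This reduces neighbourhoods to
    sequences, as dominated convergence requires. *)
Lemma near_sequential (R : realType) (E : pseudoMetricType R) (p : E)
    (Q : E -> Prop) :
  (forall u : nat -> E, u n @[n --> \oo] --> p -> exists n, Q (u n)) ->
  \forall q \near p, Q q.
Proof.
move=> H; apply: contrapT => nQ.
have /choice[u uP] : forall n : nat, exists q : E,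
    ball p (n.+1%:R^-1 : R) q /\ ~ Q q.
  move=> n; apply: contrapT => /forallNP nH; apply: nQ.
  apply: filterS (nbhsx_ballx p (n.+1%:R^-1 : R) _) => //= q pq.
  by apply: contrapT => nq; exact: (nH q).
have /H[n Qn] : u n @[n --> \oo] --> p.
  apply/cvg_ballP => e e0.
  near=> n; apply: (@le_ball _ _ _ (n.+1%:R^-1 : R)); last by have [] := uP n.
  apply: ltW; near: n; exact: (near_infty_natSinv_lt (PosNum e0)).
by have [] := uP n.
Unshelve. all: by end_near. Qed.

Section density_continuity.
Context d (T : measurableType d) (R : realType) (E : pseudoMetricType R).
Variables (lambda : {measure set T -> \bar R}).
Variables (m : E -> {measure set T -> \bar R}) (f : E -> T -> R).
Hypothesis mf : forall q, has_density lambda (m q) (f q).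

(** The positive part of [f p - f q] tends to 0 pointwise and is at most [f p], densities being
    nonnegative; its integral over the whole space bounds the loss for every [A] at once. *)
Lemma density_lower_approx (p : E) (e : R) : (0 < e)%R ->
  m p setT < +oo -> (forall y, f q y @[q --> p] --> f p y) ->
  \forall q \near p, forall A, measurable A -> m p A <= m q A + e%:E.
Proof.
move=> e0 mpoo fp; apply: near_sequential => u up.
have [mfp fp0 mpE] := mf p.
pose g n y : \bar R := (Num.max 0 (f p y - f (u n) y))%:E.
have mg n : measurable_fun setT (g n).
  apply/measurable_EFinP; apply: measurable_maxr => //.
  by apply: measurable_funB => //; have [] := mf (u n).
have g0 n y : 0 <= g n y by rewrite lee_fin le_max lexx.
have [||| _ _ /= gcvg] := @dominated_convergence _ _ _ lambda setT measurableT
    g (cst 0) (fun y => (f p y)%:E) mg (measurable_cst _).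
- apply/nearW => y _; apply/fine_cvgP; split; first exact: nearW.
  apply/cvgrPdist_lt => r r0.
  have : f (u n) y @[n --> \oo] --> f p y by exact: (cvg_comp _ _ up (fp y)).
  move=> /cvgrPdist_lt/(_ r r0); apply: filterS => n fn /=.
  rewrite sub0r normrN ger0_norm ?le_max ?lexx// gt_max r0.
  exact: le_lt_trans (ler_norm _) fn.
- apply/integrableP; split; first exact/measurable_EFinP.
  rewrite (eq_integral (fun y => (f p y)%:E)) -?mpE// => y _.
  by rewrite gee0_abs ?lee_fin.
- apply/nearW => y n _; rewrite gee0_abs// lee_fin ge_max fp0/= lerBlDr lerDl.
  by have [] := mf (u n).
have : \forall n \near \oo, \int[lambda]_y g n y < e%:E.
  move: gcvg; rewrite integral0 => /fine_cvgP[fing].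
  move=> /cvgrPdist_lt/(_ e e0); apply: filterS2 fing => n fin.
  rewrite sub0r normrN ger0_norm ?fine_ge0 ?integral_ge0//.
  by rewrite -lte_fin fineK.
case=> n _ /(_ n (leqnn n)) /= gn; exists n => A mA.
have [mfn fn0 mnE] := mf (u n).
have mEF q : measurable_fun setT (EFin \o f q).
  by apply/measurable_EFinP; have [] := mf q.
rewrite mpE// mnE//.
apply: (@le_trans _ _ (\int[lambda]_(x in A) ((f (u n) x)%:E + g n x))).
  apply: ge0_le_integral => //.
  - by move=> y _; rewrite lee_fin.
  - exact/measurable_funTS/mEF.
  - by apply/measurable_funTS/emeasurable_funD; [exact: mEF|exact: mg].
  - by move=> y _; rewrite -EFinD lee_fin -lerBlDl le_max lexx orbT.
rewrite ge0_integralD//; last 3 first.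
- by move=> y _; rewrite lee_fin.
- exact/measurable_funTS/mEF.
- exact/measurable_funTS/mg.
apply: leeD2l; apply/ltW/(le_lt_trans _ gn).
exact: ge0_subset_integral.
Qed.

End density_continuity.

Lemma near_finite_set (E : Type) (F : set_system E) (I : choiceType)
    (J : set I) (Q : I -> E -> Prop) : Filter F -> finite_set J ->
  (forall i, J i -> \forall q \near F, Q i q) ->
  \forall q \near F, forall i, J i -> Q i q.
Proof.
move=> FF /finite_fsetP[D ->] H.
have := @filter_bigI _ _ D Q F FF H.
by apply: filterS => q Hq i iD; exact: Hq.
Qed.

Section weights_continuity.
Context (R : realType) (E : topologicalType) (I : choiceType).
Variable b : I -> E -> R.
Hypothesis b0 : forall i q, (0 <= b i q)%R.

(** The discrete counterpart: a finite set [J] carries all but [e / 2] of the total weight at [p],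
    and the finitely many weights in [J] are continuous. The neighbourhood does not depend on [w],
    because the atoms themselves will move with [q]. *)
Lemma esum_lower_approx (p : E) (e : R) : (0 < e)%R ->
  \esum_(i in [set: I]) (b i p)%:E < +oo ->
  (forall i, b i q @[q --> p] --> b i p) ->
  \forall q \near p, forall w : I -> \bar R, (forall i, 0 <= w i <= 1) ->
    \esum_(i in [set: I]) ((b i p)%:E * w i) <=
    \esum_(i in [set: I]) ((b i q)%:E * w i) + e%:E.
Proof.
move=> e0 bpoo bp.
have e20 : (0 < e / 2)%R by rewrite divr_gt0.
set S := \esum_(i in [set: I]) (b i p)%:E in bpoo.
have Sfin : S \is a fin_num by rewrite ge0_fin_numE// esum_ge0// => i _; rewrite lee_fin.
have [_ [J [finJ _]] <- SJ] := ub_ereal_sup_adherent e20 Sfin.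
(* The successor of the size allows [J] to be empty; the losses on [J] add up to at most [e / 2]. *)
set c := (e / 2 / (size (finmap.enum_fset (fset_set J))).+1%:R)%R.
have c0 : (0 < c)%R by rewrite divr_gt0.
have bJ : \forall q \near p, forall i, J i -> (b i p <= b i q + c)%R.
  apply: near_finite_set => // i _.
  have /cvgrPdist_le/(_ c c0) := bp i; apply: filterS => q.
  by rewrite ler_norml => /andP[_]; rewrite lerBlDl.
apply: filterS bJ => q bJ w w01.
have w0 i : 0 <= w i by have /andP[] := w01 i.
have w1 i : w i <= 1 by have /andP[] := w01 i.
(* The loss allowed at index [i]: [c] on [J], the whole weight outside. *)
pose r i : \bar R := if i \in J then c%:E else (b i p)%:E.
have r0 i : 0 <= r i by rewrite /r; case: ifP => _; rewrite lee_fin// ltW.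
apply: (@le_trans _ _ (\esum_(i in [set: I]) ((b i q)%:E * w i + r i))).
  apply: le_esum => i _; rewrite /r; case: ifPn => [/set_mem Ji|_].
    apply: (@le_trans _ _ ((b i q + c)%:E * w i)).
      by apply: lee_wpmul2r => //; rewrite lee_fin bJ.
    rewrite EFinD ge0_muleDl ?lee_fin ?(ltW c0)//; apply: leeD2l.
    by rewrite -[leRHS]mule1 lee_wpmul2l// lee_fin ltW.
  apply: (@le_trans _ _ (b i p)%:E).
    by rewrite -[leRHS]mule1 lee_wpmul2l// lee_fin.
  by rewrite leeDr// mule_ge0// lee_fin.
rewrite esumD//; last by move=> i _; rewrite mule_ge0// lee_fin.
apply: leeD2l.
have JE (a : I -> \bar R) : (forall i, 0 <= a i) ->
    \esum_(i in [set: I]) a i = \sum_(i \in J) a i + \esum_(i in ~` J) a i.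
  by move=> a0; rewrite (esumID J)// !setTI esum_fset.
rewrite JE// [in e%:E](splitr e) EFinD; apply: leeD.
  rewrite (eq_fsbigr (fun=> c%:E)); last by move=> i iJ; rewrite /r iJ.
  rewrite fsbig_finite//= sumEFin lee_fin big_const_seq count_predT iter_addr_0.
  by rewrite -[leLHS]mulr_natr /c mulrAC ler_pdivrMr ?ltr0n// ler_pM2l// ler_nat.
rewrite (eq_esum (b := fun i => (b i p)%:E)); last first.
  by move=> i /= nJ; rewrite /r memNset.
have Jfin : (\sum_(i \in J) (b i p)%:E)%R \is a fin_num.
  by rewrite fsbig_finite//= sumEFin.
have : S - (e / 2)%:E <= (\sum_(i \in J) (b i p)%:E)%R by exact: ltW.
rewrite leeBlDr// /S JE; last by move=> i; rewrite lee_fin.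
by rewrite leeD2lE.
Qed.

End weights_continuity.

(** * Complements, and limits under the integral *)

(** Stated for set functions since it is applied to [frozen] and to the law of [X_ t], which are not
    packaged as measures. *)
Lemma le_approx_setC d (T : measurableType d) (R : realType)
    (mu nu : set T -> \bar R) (e : R) :
  (forall A, measurable A -> 0 <= mu A) ->
  (forall A, measurable A -> 0 <= nu A) ->
  (forall A, measurable A -> mu A + mu (~` A) = 1) ->
  (forall A, measurable A -> nu A + nu (~` A) = 1) ->
  (forall A, measurable A -> mu A <= nu A + e%:E) ->
  forall A, measurable A -> nu A <= mu A + e%:E.
Proof.
move=> mu0 nu0 mu1 nu1 munu A mA.
have fin (m : set T -> \bar R) D : (forall A, measurable A -> 0 <= m A) ->
    (forall A, measurable A -> m A + m (~` A) = 1) -> measurable D ->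
    m D \is a fin_num.
  move=> m0 m1 mD; rewrite ge0_fin_numE ?m0// (@le_lt_trans _ _ 1) ?ltry//.
  by rewrite -(m1 _ mD) leeDl// m0//; exact: measurableC.
have mB := measurableC mA.
have := munu _ mB; move: (mu1 _ mA) (nu1 _ mA).
rewrite -(fineK (fin mu A mu0 mu1 mA)) -(fineK (fin nu A nu0 nu1 mA)).
rewrite -(fineK (fin mu _ mu0 mu1 mB)) -(fineK (fin nu _ nu0 nu1 mB)).
rewrite -!EFinD !lee_fin => -[muC] [nuC]; lra.
Qed.

Lemma measure1C d (T : measurableType d) (R : realType)
    (mu : {measure set T -> \bar R}) A :
  mu setT = 1 -> measurable A -> mu A + mu (~` A) = 1.
Proof.
move=> mu1 mA; rewrite -measureU ?setICr ?setUv//; exact: measurableC.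
Qed.

Lemma le_approxC d (T : measurableType d) (R : realType)
    (mu nu : {measure set T -> \bar R}) (e : R) :
  mu setT = 1 -> nu setT = 1 ->
  (forall A, measurable A -> mu A <= nu A + e%:E) ->
  forall A, measurable A -> nu A <= mu A + e%:E.
Proof.
move=> mu1 nu1; apply: le_approx_setC => // A mA; exact: measure1C.
Qed.

(** The positive part of the excess is at most 1 and tends to 0 at each [y], uniformly in [A];
    dominated convergence then keeps the uniformity in [A] after integration. *)
Lemma integral_lower_approx d d' (T : measurableType d) (T' : measurableType d')
    (R : realType) (E : pseudoMetricType R) (mu : {measure set T -> \bar R})
    (F : E -> set T' -> T -> \bar R) (p : E) (e : R) :
  (0 < e)%R -> mu setT < +oo ->
  (forall q A, measurable A -> measurable_fun setT (F q A)) ->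
  (forall q A y, measurable A -> 0 <= F q A y <= 1) ->
  (forall y e', (0 < e')%R -> \forall q \near p, forall A, measurable A ->
     F q A y <= F p A y + e'%:E) ->
  \forall q \near p, forall A, measurable A ->
    \int[mu]_y F q A y <= \int[mu]_y F p A y + e%:E.
Proof.
move=> e0 muoo mF F01 Fp; apply: near_sequential => u up.
have F0 q A y : measurable A -> 0 <= F q A y by move=> /(F01 q A y)/andP[].
have F1 q A y : measurable A -> F q A y <= 1 by move=> /(F01 q A y)/andP[].
have Ffin q A y : measurable A -> F q A y \is a fin_num.
  by move=> mA; rewrite ge0_fin_numE ?F0// (le_lt_trans (F1 _ _ _ mA)) ?ltry.
(* A set that violates the bound whenever there is one: it makes the
   functions below a sequence, so that no supremum over A is integrated. *)
have /choice[A AP] : forall n, exists A, measurable A /\ forall A', measurable A' ->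
    \int[mu]_y F (u n) A y <= \int[mu]_y F p A y + e%:E ->
    \int[mu]_y F (u n) A' y <= \int[mu]_y F p A' y + e%:E.
  move=> n; have [[A [mA nA]]|/forallNP H] := pselect (exists A, measurable A /\
      ~ \int[mu]_y F (u n) A y <= \int[mu]_y F p A y + e%:E).
    by exists A.
  exists set0; split=> // A' mA' _; apply: contrapT => nA'.
  by apply: (H A').
have mA n : measurable (A n) by have [] := AP n.
pose g n y := maxe 0 (F (u n) (A n) y - F p (A n) y).
have mg n : measurable_fun setT (g n).
  apply: measurable_maxe; first exact: measurable_cst.
  by apply: emeasurable_funB; exact: mF.
have g0 n y : 0 <= g n y by rewrite le_max lexx.
have g1 n y : g n y <= 1.
  rewrite ge_max lee01/=; apply: le_trans (F1 (u n) (A n) y (mA n)).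
  by rewrite leeBlDr ?Ffin// leeDl// F0.
have gfin n y : g n y \is a fin_num.
  by rewrite ge0_fin_numE// (le_lt_trans (g1 n y)) ?ltry.
have [||| _ _ /= gcvg] := @dominated_convergence _ _ _ mu setT measurableT
    g (cst 0) (cst 1) mg (measurable_cst _).
- apply/nearW => y _; apply/fine_cvgP; split.
    exact: nearW.
  apply/cvgrPdist_le => r r0 /=.
  have : \forall n \near \oo, forall A, measurable A ->
      F (u n) A y <= F p A y + r%:E by exact: up _ (Fp y r r0).
  apply: filterS => n /(_ (A n) (mA n)) Fn.
  rewrite sub0r normrN ger0_norm ?fine_ge0//.
  rewrite -lee_fin fineK//.
  by rewrite /g ge_max lee_fin (ltW r0)/= leeBlDl ?Ffin.
- apply/integrableP; split; first exact: measurable_cst.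
  by under eq_integral do rewrite /= normr1; rewrite integral_cst// mul1e.
- by apply/nearW => y n _; rewrite gee0_abs.
have : \forall n \near \oo, \int[mu]_y g n y < e%:E.
  move: gcvg; rewrite integral0 => /fine_cvgP[fing].
  move=> /cvgrPdist_lt/(_ e e0); apply: filterS2 fing => n fin.
  rewrite sub0r normrN ger0_norm ?fine_ge0 ?integral_ge0//.
  by rewrite -lte_fin fineK.
case=> n _ /(_ n (leqnn n)) /= gn; exists n => A' mA'.
apply: (AP n).2 => //.
apply: (@le_trans _ _ (\int[mu]_y (F p (A n) y + g n y))).
  apply: ge0_le_integral => //.
  - by move=> y _; exact: F0.
  - exact: mF.
  - by apply: emeasurable_funD => //; exact: mF.
  - by move=> y _; rewrite -leeBlDl ?Ffin// le_max lexx orbT.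
rewrite ge0_integralD//; last 2 first.
- by move=> y _; exact: F0.
- exact: mF.
by apply: leeD2l; exact: ltW.
Qed.

Lemma kpow1 d (T : measurableType d) (R : realType) (k : R.-pker T ~> T) x A :
  measurable A -> kpow k 1 x A = k x A.
Proof.
move=> mA; rewrite kpowSr// [LHS](integral_dirac _ measurableT).
  by rewrite diracT mul1e.
exact: measurable_kernel.
Qed.

Lemma prob_kernel_ltoo d (T : measurableType d) (R : realType)
    (k : R.-pker T ~> T) x : k x setT < +oo.
Proof. by rewrite prob_kernel ltry. Qed.

Lemma kpow_le1 d (T : measurableType d) (R : realType) (k : R.-pker T ~> T)
    t x A : measurable A -> 0 <= kpow k t x A <= 1.
Proof.
move=> mA; rewrite measure_ge0/= -(@prob_kernel _ _ _ _ _ (kpow k t) x).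
by rewrite le_measure// inE.
Qed.

Lemma integral_add_dirac d (T : measurableType d) (R : realType)
    (m : {measure set T -> \bar R}) (k : {nonneg R}) a (h : T -> \bar R) :
  measurable_fun setT h -> (forall x, 0 <= h x) ->
  \int[measure_add m (mscale k (\d_a))]_x h x =
  \int[m]_x h x + k%:num%:E * h a.
Proof.
move=> mh h0; rewrite ge0_integral_measure_add//; congr (_ + _).
by rewrite ge0_integral_mscale// integral_dirac// diracT mul1e.
Qed.

(** * Ergodicity for a fixed parameter *)

Section kernel_family.
Context (R : realType) (dX dT : measure_display)
  (X : metricMeasurableType dX R) (Theta : metricMeasurableType dT R)
  (lambda : {measure set X -> \bar R}) (pi : probability X R)
  (P : Theta -> R.-pker X ~> X)
  (Ptilde B : nat -> Theta -> X -> {measure set X -> \bar R})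
  (ptilde : nat -> Theta -> X -> X -> R).
Hypothesis pi_dom : forall N, measurable N -> lambda N = 0 -> pi N = 0.
Hypothesis P_decomposition : forall t theta x, (1 <= t)%N ->
  lebesgue_decomposition lambda (kernel_iter (P theta) t x)
    (Ptilde t theta x) (B t theta x) /\
  has_density lambda (Ptilde t theta x) (ptilde t theta x).
Hypothesis ergodic : forall theta x,
  tv_norm (fun A => kernel_iter (P theta) t x A - pi A) @[t --> \oo] --> 0.

Lemma kpow_decomposition t theta x A : (1 <= t)%N -> measurable A ->
  kpow (P theta) t x A = Ptilde t theta x A + B t theta x A.
Proof.
by move=> t1 mA; have [[<- //]] := P_decomposition theta x t1; rewrite kernel_iterE.
Qed.

Lemma Ptilde_ltoo t theta x : (1 <= t)%N -> Ptilde t theta x setT < +oo.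
Proof.
move=> t1; apply: (@le_lt_trans _ _ (kpow (P theta) t x setT)).
  by rewrite kpow_decomposition// leeDl.
by rewrite prob_kernel ltry.
Qed.

Lemma kpow_ergodic theta x e : (0 < e)%R -> \forall t \near \oo,
  forall A, measurable A -> kpow (P theta) t x A <= pi A + e%:E.
Proof.
move=> e0; have /fine_cvgP[tvfin /cvgrPdist_lt/(_ e e0)] := @ergodic theta x.
apply: filterS2 tvfin => t tvfin; rewrite sub0r normrN => tvlt A mA.
have : `|kernel_iter (P theta) t x A - pi A| <= e%:E.
  apply: (@le_trans _ _ (tv_norm (fun A => kernel_iter (P theta) t x A - pi A))).
    by apply: ereal_sup_ubound; exists A.
  by rewrite -(fineK tvfin) lee_fin ltW// (le_lt_trans (ler_norm _)).
move=> /(le_trans (lee_abs _)).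
by rewrite leeBlDr ?fin_num_measure// addeC kernel_iterE.
Qed.

(** For large [N], the laws [kpow N x] and [kpow N.+1 x] are both within [e / 2] of [pi], and
    integrating [P theta] against the former yields the latter. *)
Lemma pi_subinvariant theta A : measurable A -> \int[pi]_y P theta y A <= pi A.
Proof.
move=> mA.
have mPA : measurable_fun setT (fun y => P theta y A) by exact: measurable_kernel.
have P01 y : 0 <= P theta y A <= 1 by rewrite -(kpow1 _ _ mA) kpow_le1.
(* A starting state exists because [pi] has mass 1. *)
have [x _] : exists x : X, True.
  apply: contrapT => /forallNP H.
  have : pi setT = 0.
    by rewrite (_ : setT = set0) ?measure0//; apply/seteqP; split=> // x /H.
  by rewrite probability_setT => /eqP; rewrite onee_eq0.
apply/lee_addgt0Pr => e e0.
have e20 : (0 < e / 2)%R by rewrite divr_gt0.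
have [N _ HN] := kpow_ergodic theta x e20.
have piN : forall A, measurable A -> pi A <= kpow (P theta) N x A + (e / 2)%:E.
  apply: le_approxC; [exact: prob_kernel|exact: probability_setT|].
  by apply: HN => /=.
have pioo : pi setT < +oo by rewrite probability_setT ltry.
apply: (le_trans (le_integral_approx_measure pioo (prob_kernel_ltoo _ x)
  piN mPA P01)).
rewrite -kpowSr// [in leRHS](splitr e) EFinD addeA.
by apply: leeD2r; apply: HN => /=.
Qed.

(** Applying one more step to both measures keeps the error [e], and [pi] does not increase under a
    step. *)
Lemma kpow_close_nondecreasing theta x e s t : (s <= t)%N ->
  (forall A, measurable A -> kpow (P theta) s x A <= pi A + e%:E) ->
  forall A, measurable A -> kpow (P theta) t x A <= pi A + e%:E.
Proof.
move=> /subnK <-; elim: (t - s)%N => // n ih Hs A mA.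
rewrite addSn kpowSr//; apply: (@le_trans _ _ (\int[pi]_y P theta y A + e%:E)).
  have pioo : pi setT < +oo by rewrite probability_setT ltry.
  apply: (le_integral_approx_measure (prob_kernel_ltoo _ x) pioo (ih Hs)).
    exact: measurable_kernel.
  by move=> y; rewrite -(kpow1 _ _ mA) kpow_le1.
by apply: leeD2r; exact: pi_subinvariant.
Qed.

Definition ptilde_continuous t :=
  continuous (fun v : X * Theta * X => ptilde t v.1.2 v.1.1 v.2).

Lemma ptilde_continuous_at t (p : X * Theta) y : ptilde_continuous t ->
  ptilde t q.2 q.1 y @[q --> p] --> ptilde t p.2 p.1 y.
Proof.
move=> ct; have py : (q, y) @[q --> p] --> (p, y).
  exact: (cvg_pair cvg_id (cvg_cst _)).
exact: (cvg_comp _ _ py (ct (p, y))).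
Qed.

Lemma Ptilde_lower_approx t (p : X * Theta) e : (1 <= t)%N ->
  ptilde_continuous t -> (0 < e)%R ->
  \forall q \near p, forall A, measurable A ->
    Ptilde t p.2 p.1 A <= Ptilde t q.2 q.1 A + e%:E.
Proof.
move=> t1 ct e0.
apply: (@density_lower_approx _ _ _ (X * Theta)%type lambda
  (fun q => Ptilde t q.2 q.1) (fun q => ptilde t q.2 q.1)) => //.
- by move=> q; have [] := P_decomposition q.2 q.1 t1.
- exact: Ptilde_ltoo.
- by move=> y; exact: ptilde_continuous_at.
Qed.

(** * Kernels with a density and moving atoms *)

Section atomic_part.
Context (I : countType) (b : I -> X * Theta -> R) (s : I -> X -> X).
Hypothesis atomic : atomic_decomposition (B 1%N) b s.
Hypothesis c1 : ptilde_continuous 1.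

(* The kernel at p with its atoms moved to where they sit for the state y. *)
Definition frozen (p : X * Theta) (y : X) (A : set X) : \bar R :=
  Ptilde 1 p.2 p.1 A + \esum_(i in [set: I]) ((b i p)%:E * \d_(s i y) A).

Lemma frozenE p A : measurable A -> P p.2 p.1 A = frozen p p.1 A.
Proof.
move=> mA; rewrite -kpow1// kpow_decomposition//; congr (_ + _).
have [_ _ _ ->//] := atomic; by case: p.
Qed.

Let b0 i q : (0 <= b i q)%R. Proof. by have [] := atomic. Qed.

Let d01 y (A : set X) i : 0 <= (\d_(s i y) A : \bar R) <= 1.
Proof.
by rewrite diracE; case: (_ \in _); rewrite /= ?lee01 lexx.
Qed.

Lemma frozen_ge0 p y A : 0 <= frozen p y A.
Proof.
by rewrite adde_ge0// esum_ge0// => i _; rewrite mule_ge0 ?lee_fin.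
Qed.

(** The whole space receives the same mass wherever the atoms sit. *)
Lemma frozenT p y : frozen p y setT = 1.
Proof.
by rewrite -(@prob_kernel _ _ _ _ _ (P p.2) p.1) frozenE.
Qed.

Lemma frozenC p y A : measurable A -> frozen p y A + frozen p y (~` A) = 1.
Proof.
move=> mA; rewrite -(frozenT p y) addeACA; congr (_ + _).
  by rewrite -measureU ?setICr ?setUv//; exact: measurableC.
rewrite -esumD; last 2 first.
- by move=> i _; rewrite mule_ge0 ?lee_fin.
- by move=> i _; rewrite mule_ge0 ?lee_fin.
apply: eq_esum => i _; rewrite -muleDr ?ge0_adde_def ?inE//.
by rewrite -measureU ?setICr ?setUv//; exact: measurableC.
Qed.

Lemma esum_weights_le1 p : \esum_(i in [set: I]) (b i p)%:E <= 1.
Proof.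
rewrite -(frozenT p p.1) (eq_esum (b := fun i => (b i p)%:E * \d_(s i p.1) setT)).
  by rewrite leeDr.
by move=> i _; rewrite diracT mule1.
Qed.

(** Both measures have their atoms at the points [s i q.1], so they differ only through the density
    and the weights, each of which costs [e / 2]. *)
Lemma frozen_le_kernel p e : (0 < e)%R ->
  \forall q \near p, forall A, measurable A ->
    frozen p q.1 A <= P q.2 q.1 A + e%:E.
Proof.
move=> e0; have e20 : (0 < e / 2)%R by rewrite divr_gt0.
have /Ptilde_lower_approx/(_ c1 e20) := leqnn 1 => /(_ p).
have [_ cb _ _] := atomic.
have boo : \esum_(i in [set: I]) (b i p)%:E < +oo.
  by rewrite (le_lt_trans (esum_weights_le1 p))// ltry.
have := esum_lower_approx b0 e20 boo (fun i => cb i p).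
apply: filterS2 => q Hb HP A mA; rewrite frozenE// [in leRHS](splitr e) EFinD.
by rewrite addeACA; apply: leeD; [exact: HP|exact: Hb].
Qed.

Lemma kernel_le_frozen p e : (0 < e)%R ->
  \forall q \near p, forall A, measurable A ->
    P q.2 q.1 A <= frozen p q.1 A + e%:E.
Proof.
move=> e0; apply: filterS (frozen_le_kernel p e0) => q H.
apply: le_approx_setC H => //.
- by move=> A mA; exact: frozen_ge0.
- by move=> A mA; exact: frozenC.
- by move=> A mA; apply: measure1C => //; exact: prob_kernel.
Qed.

(* Only theta' moves, so both kernels are compared to the same frozen measure
   and the moving atoms cancel. *)
Lemma kernel_equicontinuous (C : set (X * Theta)) e : compact C -> (0 < e)%R ->
  exists2 eta : R, (0 < eta)%R & forall x theta theta', C (x, theta) ->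
    (mdist theta theta' < eta)%R ->
    forall A, measurable A -> P theta x A <= P theta' x A + e%:E.
Proof.
move=> /compact_near_coveringP cC e0.
have e20 : (0 < e / 2)%R by rewrite divr_gt0.
pose Q (eta : R) (q : X * Theta) := forall theta', (mdist q.2 theta' < eta)%R ->
  forall A, measurable A -> P q.2 q.1 A <= P theta' q.1 A + e%:E.
(* Compactness, as near covering along [eta] decreasing to 0, yields one [eta] for all of [C]. *)
have : \forall eta \near (0:R)^'+, C `<=` Q eta.
  apply: cC => p _.
  have [r /= r0 Hr] := (@nbhs_ballP R (X * Theta)%type p _).1
    (filterI (kernel_le_frozen p e20) (frozen_le_kernel p e20)).
  have r20 : (0 < r / 2)%R by rewrite divr_gt0.
  (* Half of the radius is for the pair [q], half for the drift, so that [(q.1, theta')] stays in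
     the ball of radius [r]. *)
  exists (ball p (r / 2), [set eta | (eta < r / 2)%R]).
    split; first exact: nbhsx_ballx.
    exact: nbhs_right_lt.
  move=> [q eta] /= [[pq1 pq2] etar] theta' qtheta' A mA.
  have inball (q' : X * Theta) : ball p.1 r q'.1 -> ball p.2 r q'.2 -> ball p r q'.
    by split.
  have rr : (r / 2 <= r)%R by rewrite ler_pdivrMr// ler_pMr// ler1n.
  have pq1r : ball p.1 r q.1 by exact: le_ball rr _ pq1.
  have pq2r : ball p.2 r q.2 by exact: le_ball rr _ pq2.
  have pth : ball p.2 r theta'.
    rewrite (splitr r); apply: (ball_triangle pq2).
    by rewrite ballEmdist/=; exact: lt_trans etar.
  have [H1 _] := Hr _ (inball q pq1r pq2r).
  have [_ H2] := Hr _ (inball (q.1, theta') pq1r pth).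
  apply: (le_trans (H1 A mA)); rewrite [in leRHS](splitr e) EFinD addeA.
  by apply: leeD2r; exact: H2.
move=> H; near (0:R)^'+ => eta; exists eta => //.
move=> x theta theta' Cx; exact: (near H eta _ (x, theta)).
Unshelve. all: by end_near. Qed.

(** * Case (II): constant or identity atoms *)

Section constant_or_identity.
Hypothesis s_cst_or_id :
  forall i, (exists a, forall x, s i x = a) \/ (forall x, s i x = x).

Definition id_atoms := [set i : I | forall x, s i x = x].

(** The mass that the identity atoms leave at the current state; [fine] loses nothing, the weights
    summing to at most 1. *)
Definition stay (p : X * Theta) : R :=
  fine (\esum_(i in id_atoms) (b i p)%:E).

Lemma stay_esum p : \esum_(i in id_atoms) (b i p)%:E = (stay p)%:E.
Proof.
rewrite fineK// ge0_fin_numE ?esum_ge0//; last by move=> i _; rewrite lee_fin.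
apply: (@le_lt_trans _ _ 1); last by rewrite ltry.
apply: le_trans (esum_weights_le1 p); rewrite [leRHS](esumID id_atoms)//.
  by rewrite setTI leeDl// esum_ge0// => i _; rewrite lee_fin.
by move=> i _; rewrite lee_fin.
Qed.

Lemma stay_ge0 p : (0 <= stay p)%R.
Proof. by rewrite -lee_fin -stay_esum esum_ge0// => i _; rewrite lee_fin. Qed.

Lemma stay_le1 p : (stay p <= 1)%R.
Proof.
rewrite -lee_fin -stay_esum; apply: le_trans (esum_weights_le1 p).
rewrite [leRHS](esumID id_atoms); last by move=> i _; rewrite lee_fin.
by rewrite setTI leeDl// esum_ge0// => i _; rewrite lee_fin.
Qed.

Definition stay_nng p : {nonneg R} := NngNum (stay_ge0 p).

Lemma esum_stay p y (A : set X) :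
  \esum_(i in id_atoms) ((b i p)%:E * \d_(s i y) A) = (stay p)%:E * \d_y A.
Proof.
rewrite -stay_esum diracE; have [yA|yA] := boolP (y \in A).
  by rewrite mule1; apply: eq_esum => i /= si; rewrite si diracE yA mule1.
by rewrite mule0; apply: esum1 => i /= si; rewrite si diracE (negbTE yA) mule0.
Qed.

(** Constant atoms do not move, so passing from [p.1] to [y] only carries the mass [stay p] along.
    The additive form avoids subtraction of extended reals. *)
Lemma frozen_shift p y A : measurable A ->
  frozen p y A + (stay p)%:E * \d_(p.1) A =
  P p.2 p.1 A + (stay p)%:E * \d_y A.
Proof.
move=> mA; rewrite frozenE// /frozen.
have bd0 z i : [set: I] i -> 0 <= (b i p)%:E * (\d_(s i z) A : \bar R).
  by move=> _; rewrite mule_ge0// lee_fin.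
have SE z : \esum_(i in [set: I]) ((b i p)%:E * \d_(s i z) A) =
    (stay p)%:E * \d_z A + \esum_(i in ~` id_atoms) ((b i p)%:E * \d_(s i z) A).
  by rewrite (esumID id_atoms _ _ (bd0 z)) !setTI esum_stay.
rewrite !SE (@eq_esum _ _ _ _ (fun i => (b i p)%:E * \d_(s i p.1) A)).
  rewrite -!addeA; congr (_ + _).
  by rewrite addeCA [in RHS]addeC addeA.
move=> i /= nid; congr (_ * _).
by have [[a sa]|//] := s_cst_or_id i; rewrite !sa.
Qed.

Lemma stay_dirac_le_kernel p A : measurable A ->
  (stay p)%:E * \d_(p.1) A <= B 1 p.2 p.1 A.
Proof.
move=> mA; have [_ _ _ ->//] := atomic; rewrite -surjective_pairing.
rewrite [leRHS](esumID id_atoms); last first.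
  by move=> i _; rewrite mule_ge0// lee_fin.
rewrite setTI esum_stay leeDl// esum_ge0// => i _.
by rewrite mule_ge0// lee_fin.
Qed.

(** The comparison with [frozen] is turned by [frozen_shift] into one between kernels completed by a
    Dirac mass, and then integrated. *)
Lemma integral_kernel_approx p q e h : (forall A, measurable A ->
    P q.2 q.1 A <= frozen p q.1 A + e%:E) ->
  measurable_fun setT h -> (forall x, 0 <= h x <= 1) ->
  \int[P q.2 q.1]_y h y + (stay p)%:E * h p.1 <=
  \int[P p.2 p.1]_y h y + (stay p)%:E * h q.1 + e%:E.
Proof.
move=> H mh h01.
have h0 x : 0 <= h x by have /andP[] := h01 x.
rewrite -!(integral_add_dirac _ (stay_nng p))//.
have moo (m : {measure set X -> \bar R}) a : m setT < +oo ->
    measure_add m (mscale (stay_nng p) \d_a) setT < +oo.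
  move=> moo; rewrite measure_addE; apply: lte_add_pinfty => //.
  rewrite (_ : _ setT = (stay p)%:E * \d_a setT)//.
  by rewrite diracT mule1 ltry.
have le_add A : measurable A ->
    measure_add (P q.2 q.1) (mscale (stay_nng p) \d_(p.1)) A <=
    measure_add (P p.2 p.1) (mscale (stay_nng p) \d_(q.1)) A + e%:E.
  move=> mA; rewrite !measure_addE.
  apply: (@le_trans _ _ (frozen p q.1 A + e%:E + (stay p)%:E * \d_(p.1) A)).
    by apply: leeD2r; exact: H.
  by rewrite addeAC frozen_shift.
exact: (le_integral_approx_measure (moo _ _ (prob_kernel_ltoo _ _))
  (moo _ _ (prob_kernel_ltoo _ _)) le_add mh h01).
Qed.

(** The state is fixed, so no atom moves in the first step, which costs [e / 2]; the remaining steps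
    are handled by induction under the integral. *)
Lemma kpow_param_approx t theta y e : (0 < e)%R ->
  \forall theta' \near theta, forall A, measurable A ->
    kpow (P theta') t y A <= kpow (P theta) t y A + e%:E.
Proof.
elim: t y e => [|t ih] y e e0.
  by apply/nearW => theta' A mA; rewrite leeDl// lee_fin ltW.
have e20 : (0 < e / 2)%R by rewrite divr_gt0.
have mk k : forall theta' A, measurable A ->
    measurable_fun setT (fun z => kpow (P theta') k z A).
  by move=> theta' A mA; exact: measurable_kernel.
have := @integral_lower_approx _ _ _ _ R Theta (P theta y)
  (fun theta' A z => kpow (P theta') t z A) theta (e / 2) e20
  (prob_kernel_ltoo _ _) (mk t) (fun theta' A z => @kpow_le1 _ _ _ _ t z A)
  (fun z e' => ih z e').
have yth : (y, theta') @[theta' --> theta] --> (y, theta).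
  exact: (cvg_pair (cvg_cst _) cvg_id).
have : \forall theta' \near theta, forall A, measurable A ->
    P theta' y A <= frozen (y, theta) y A + (e / 2)%:E.
  exact: yth _ (kernel_le_frozen (y, theta) e20).
apply: filterS2 => theta' HP Hint A mA.
rewrite [X in X <= _]/= [X in _ <= X + _]/=.
apply: (@le_trans _ _ (\int[P theta y]_z kpow (P theta') t z A + (e / 2)%:E)).
  apply: le_integral_approx_measure; [exact: prob_kernel_ltoo..| |exact: mk|].
    by move=> D mD; rewrite (frozenE (y, theta))//; exact: HP.
  by move=> z; exact: kpow_le1.
rewrite [in leRHS](splitr e) EFinD addeA; apply: leeD2r; exact: Hint.
Qed.

(** In the first step only the mass [stay p] sits at a different place, [q.1] instead of [p.1]. The
    discrepancy after [t] steps is therefore multiplied by [stay p], starting from the trivial bound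
    1 at [t = 0]. *)
Lemma kpow_approx t (p : X * Theta) e : (0 < e)%R ->
  \forall q \near p, forall A, measurable A ->
    kpow (P q.2) t q.1 A <= kpow (P p.2) t p.1 A + (stay p ^+ t + e)%:E.
Proof.
elim: t e => [|t ih] e e0.
  apply: filterE => q A mA; apply: (@le_trans _ _ 1).
    by have /andP[] := kpow_le1 (P q.2) 0 q.1 mA.
  apply: (@le_trans _ _ (1 + e)%:E); first by rewrite lee_fin lerDl ltW.
  by rewrite expr0 leeDr.
(* Four errors of [e / 6] will occur, two of them multiplied by [stay p <= 1]. *)
have e60 : (0 < e / 6)%R by rewrite divr_gt0.
have qp : q.2 @[q --> p] --> p.2 by exact: cvg_snd.
have H1 : \forall q \near p, forall A, measurable A ->
    kpow (P q.2) t p.1 A <= kpow (P p.2) t p.1 A + (e / 6)%:E.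
  exact: qp _ (kpow_param_approx t p.2 p.1 e60).
have H2 : \forall q \near p, forall A, measurable A ->
    \int[P p.2 p.1]_z kpow (P q.2) t z A <=
    \int[P p.2 p.1]_z kpow (P p.2) t z A + (e / 6)%:E.
  apply: qp _ (@integral_lower_approx _ _ _ _ R Theta (P p.2 p.1)
    (fun theta' A z => kpow (P theta') t z A) p.2 (e / 6) e60
    (prob_kernel_ltoo _ _) _ (fun theta' A z => @kpow_le1 _ _ _ _ t z A)
    (fun z e' => @kpow_param_approx t p.2 z e')).
  by move=> theta' A mA; exact: measurable_kernel.
suff : \forall q \near p, (forall A, measurable A ->
      P q.2 q.1 A <= frozen p q.1 A + (e / 6)%:E) -> forall A, measurable A ->
    kpow (P q.2) t.+1 q.1 A <= kpow (P p.2) t.+1 p.1 A + (stay p ^+ t.+1 + e)%:E.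
  by move=> H; apply: filterS2 (kernel_le_frozen p e60) H => q Hq; exact.
apply: filterS3 H1 H2 (ih _ e60) => q H1 H2 H3 Hq A mA.
have k01 n theta z : 0 <= kpow (P theta) n z A <= 1 by exact: kpow_le1.
have kfin n theta z : exists r : R, kpow (P theta) n z A = r%:E.
  have /andP[k0 k1] := k01 n theta z; exists (fine (kpow (P theta) n z A)).
  by rewrite fineK// ge0_fin_numE// (le_lt_trans k1) ?ltry.
have {}H1 : kpow (P p.2) t p.1 A <= kpow (P q.2) t p.1 A + (e / 6)%:E.
  by apply: le_approxC H1 _ mA; exact: prob_kernel.
set c := \int[P p.2 p.1]_z kpow (P q.2) t z A in H2.
have {}H2 : c <= kpow (P p.2) t.+1 p.1 A + (e / 6)%:E by exact: H2.
have Hq' : kpow (P q.2) t.+1 q.1 A + (stay p)%:E * kpow (P q.2) t p.1 A <=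
    c + (stay p)%:E * kpow (P q.2) t q.1 A + (e / 6)%:E.
  exact: (integral_kernel_approx Hq (measurable_kernel (kpow (P q.2) t) A mA)
    (k01 t q.2)).
have [c' cE] : exists r : R, c = r%:E.
  exists (fine c); rewrite fineK// ge0_fin_numE ?integral_ge0//.
  rewrite (le_lt_trans H2)// lte_add_pinfty ?ltry//.
  by have [r ->] := kfin t.+1 p.2 p.1; rewrite ltry.
move: (H3 A mA) H1 H2 Hq'; rewrite cE.
have [a1 ->] := kfin t.+1 q.2 q.1; have [a2 ->] := kfin t.+1 p.2 p.1.
have [a3 ->] := kfin t q.2 q.1; have [a4 ->] := kfin t q.2 p.1.
have [a5 ->] := kfin t p.2 p.1.
rewrite -?EFinM -?EFinD !lee_fin exprS.
have s0 := stay_ge0 p; have s1 := stay_le1 p => H3' H1' H2' Hq''.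
have se : (stay p * e <= e)%R by rewrite ler_piMl// ltW.
have := ler_wpM2l s0 (lerB H3' H1').
move: (stay p ^+ t)%R (stay p) H3' Hq'' s0 s1 se => x y; nra.
Qed.

(* Ergodicity forces the holding probability down: the state p.1 lies in a
   lambda-null set, which pi does not charge. *)
Lemma stay_exp_le t p e : (0 < e)%R -> (1 <= t)%N ->
  (forall A, measurable A -> kpow (P p.2) t p.1 A <= pi A + e%:E) ->
  (stay p ^+ t <= e)%R.
Proof.
move=> e0 t1 H; have [->|s0] := eqVneq (stay p) 0%R.
  by rewrite expr0n gtn_eqF// ltW.
have [[_ _ [N [mN lN BN]]] _] := P_decomposition p.2 p.1 (leqnn 1).
(* Otherwise the singular part, null outside [N], would have an atom of mass [stay p > 0] there. *)
have pN : p.1 \in N.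
  have := stay_dirac_le_kernel p (measurableC mN); rewrite BN diracE in_setC.
  case: (p.1 \in N) => //=; rewrite mule1 lee_fin => s0'.
  by move: s0; rewrite eq_le s0' stay_ge0.
(* Holding at [p.1] during all [n] steps keeps the state in [N]. *)
have powN n : (stay p ^+ n)%:E <= kpow (P p.2) n p.1 N.
  elim: n => [|n ih]; first by rewrite /= /kdirac diracE pN.
  have dP A : measurable A ->
      mscale (stay_nng p) \d_(p.1) A <= P p.2 p.1 A + 0%:E.
    move=> mA; rewrite adde0; apply: (le_trans (stay_dirac_le_kernel p mA)).
    by rewrite -kpow1// kpow_decomposition// leeDr.
  have soo : mscale (stay_nng p) \d_(p.1) setT < +oo.
    rewrite (_ : _ setT = (stay p)%:E * \d_(p.1) setT)//.
    by rewrite diracT mule1 ltry.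
  have := le_integral_approx_measure soo (prob_kernel_ltoo _ _) dP
    (measurable_kernel (kpow (P p.2) n) N mN) (fun z => kpow_le1 _ n z mN).
  rewrite ge0_integral_mscale//; last exact: measurable_kernel.
  rewrite integral_dirac//; last exact: measurable_kernel.
  rewrite diracT mul1e adde0; apply: le_trans.
  by rewrite exprS EFinM; apply: lee_wpmul2l => //; rewrite lee_fin stay_ge0.
rewrite -lee_fin; apply: (le_trans (powN t)); apply: (le_trans (H N mN)).
by rewrite pi_dom// add0e.
Qed.

Lemma near_close_constant_or_identity (p : X * Theta) e : (0 < e)%R ->
  exists n, \forall q \near p, forall A, measurable A ->
    kpow (P q.2) n q.1 A <= pi A + e%:E.
Proof.
move=> e0; have e30 : (0 < e / 3)%R by rewrite divr_gt0.
have [N _ HN] := kpow_ergodic p.2 p.1 e30.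
(* The bound on the power of [stay p] requires a positive number of steps. *)
exists N.+1; have {}HN := HN N.+1 (leqnSn N).
have sN := stay_exp_le e30 (ltn0Sn N) HN.
apply: filterS (kpow_approx N.+1 p e30) => q Hq A mA.
apply: (le_trans (Hq A mA)).
apply: (@le_trans _ _ (pi A + (e / 3)%:E + (e / 3 + e / 3)%:E)).
  by apply: leeD; [exact: HN|rewrite lee_fin lerD2r].
by rewrite -addeA -EFinD; apply: leeD2l; rewrite lee_fin; lra.
Qed.

End constant_or_identity.

End atomic_part.

(** * Case (I), and uniformity on compact sets *)

(** The mass of [pi] lies outside the null set [N] carrying the singular part at [p]. There [pi] is
    bounded by the absolutely continuous part at [p], hence by the one at nearby [q], hence by the
    kernel at [q]; complements reverse the inequality. *)
Lemma near_close_continuous_density (p : X * Theta) e :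
  (forall t, (1 <= t)%N -> ptilde_continuous t) -> (0 < e)%R ->
  exists n, \forall q \near p, forall A, measurable A ->
    kpow (P q.2) n q.1 A <= pi A + e%:E.
Proof.
move=> ct e0; have e20 : (0 < e / 2)%R by rewrite divr_gt0.
have [n _ Hn] := kpow_ergodic p.2 p.1 e20.
exists n.+1; have {}Hn := Hn n.+1 (leqnSn n).
have pi_le : forall A, measurable A ->
    pi A <= kpow (P p.2) n.+1 p.1 A + (e / 2)%:E.
  by apply: le_approxC Hn; [exact: prob_kernel|exact: probability_setT].
have [[_ _ [N [mN lN BN]]] _] := P_decomposition p.2 p.1 (ltn0Sn n).
apply: filterS (Ptilde_lower_approx p (ltn0Sn n) (ct _ (ltn0Sn n)) e20) => q Hq.
apply: le_approxC; [exact: probability_setT|exact: prob_kernel|move=> A mA].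
have mAN : measurable (A `\` N) by exact: measurableD.
have piAN : pi A <= pi (A `\` N).
  rewrite -[leRHS]adde0 -(pi_dom mN lN) -measureU//; last first.
    by rewrite setDE -setIA setICl setI0.
  rewrite le_measure ?inE//; first exact: measurableU.
  by move=> x Ax; have [|] := pselect (N x); [right|left].
apply: (le_trans piAN); apply: (le_trans (pi_le _ mAN)).
rewrite kpow_decomposition// [in leRHS](splitr e) EFinD addeA; apply: leeD2r.
have -> : B n.+1 p.2 p.1 (A `\` N) = 0.
  apply/eqP; rewrite eq_le measure_ge0 andbT -BN le_measure// ?inE//.
    exact: measurableC.
rewrite adde0; apply: (@le_trans _ _ (Ptilde n.+1 p.2 p.1 A)).
  by rewrite le_measure ?inE//; exact: subDsetl.
apply: (le_trans (Hq A mA)); apply: leeD2r.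
by rewrite kpow_decomposition// leeDl.
Qed.

(** Near covering is used along [n] tending to infinity: closeness after [m] steps persists for all
    [n >= m], so the local numbers of steps can be replaced by a common one. *)
Lemma uniform_close (C : set (X * Theta)) e : compact C ->
  (forall p : X * Theta, exists n, \forall q \near p, forall A, measurable A ->
    kpow (P q.2) n q.1 A <= pi A + e%:E) ->
  exists n, forall x theta, C (x, theta) -> forall A, measurable A ->
    kpow (P theta) n x A <= pi A + e%:E.
Proof.
move=> /compact_near_coveringP cC H.
pose Q n (q : X * Theta) := forall A, measurable A ->
  kpow (P q.2) n q.1 A <= pi A + e%:E.
have : \forall n \near \oo, C `<=` Q n.
  apply: cC => p _; have [m Hm] := H p.
  exists ([set q | Q m q], [set n | (m <= n)%N]).
    by split; [exact: Hm|exists m].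
  move=> [q n] /= [Qq mn]; exact: kpow_close_nondecreasing mn Qq.
move=> [n _ Hn]; exists n => x theta Cx; exact: (Hn n (leqnn n) _ Cx).
Qed.

End kernel_family.

(** * The Markov property and the telescoping comparison *)

Section pker_of.
Context d d' (X : measurableType d) (Y : measurableType d') (R : realType)
  (k : X -> {measure set Y -> \bar R}).

(** The two proofs are arguments of the definition so that the kernel instances can be attached to
    it. *)
Definition pker_of (mk : forall U, measurable U -> measurable_fun setT (k ^~ U))
  (k1 : forall x, k x setT = 1) : X -> {measure set Y -> \bar R} := k.

Hypothesis mk : forall U, measurable U -> measurable_fun setT (k ^~ U).
Hypothesis k1 : forall x, k x setT = 1.

HB.instance Definition _ := isKernel.Build _ _ _ _ R (pker_of mk k1) mk.

HB.instance Definition _ :=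
  Kernel_isProbability.Build _ _ _ _ R (pker_of mk k1) k1.

End pker_of.

Lemma integral_indicT d (T : measurableType d) (R : realType)
    (mu : {measure set T -> \bar R}) A : measurable A ->
  \int[mu]_x (\1_A x)%:E = mu A.
Proof. by move=> mA; rewrite integral_indic// setIT. Qed.

(** Pointwise [f <= g + c + \1_D], because [f <= 1] on [D]. *)
Lemma le_integral_off_event d (T : measurableType d) (R : realType)
    (mu : probability T R) (f g : T -> \bar R) (D : set T) (c r : R) :
  measurable_fun setT f -> measurable_fun setT g ->
  (forall w, 0 <= f w <= 1) -> (forall w, 0 <= g w) ->
  (0 <= c)%R -> measurable D -> mu D <= r%:E ->
  (forall w, ~ D w -> f w <= g w + c%:E) ->
  \int[mu]_w f w <= \int[mu]_w g w + (c + r)%:E.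
Proof.
move=> mf mg f01 g0 c0 mD Dr fg.
have f0 w : 0 <= f w by have /andP[] := f01 w.
have f1 w : f w <= 1 by have /andP[] := f01 w.
have mI : measurable_fun setT (fun w => (\1_D w)%:E : \bar R).
  by apply/measurable_EFinP; exact: measurable_indic.
apply: (@le_trans _ _ (\int[mu]_w (g w + (cst c%:E w + (\1_D w)%:E)))).
  apply: ge0_le_integral => //.
    by apply: emeasurable_funD => //; exact: emeasurable_funD.
  move=> w _; have [Dw|nDw] := pselect (D w).
    apply: (le_trans (f1 w)); rewrite indicE mem_set// addeA leeDr//.
    by rewrite adde_ge0// lee_fin.
  by rewrite indicE memNset// adde0; exact: fg.
rewrite ge0_integralD//; last 2 first.
- by move=> w _; rewrite adde_ge0// lee_fin.
- exact: emeasurable_funD.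
rewrite ge0_integralD//.
rewrite integral_cst// integral_indicT// [X in _ * X]probability_setT mule1 EFinD.
by apply: leeD2l; exact: leeD2l.
Qed.

Section adaptive_chain.
Context (R : realType) (dX dT dP dO : measure_display)
  (X : measurableType dX) (Theta : measurableType dT)
  (Psi : measurableType dP) (Omega : measurableType dO)
  (P : Theta -> R.-pker X ~> X)
  (Q : R.-pker (X * Theta * Psi)%type ~> (X * Theta * Psi)%type)
  (Pr : X * Theta * Psi -> probability Omega R)
  (X_ : nat -> Omega -> X) (theta_ : nat -> Omega -> Theta)
  (psi_ : nat -> Omega -> Psi).
Hypothesis chain : adaptive_mcmc P Q Pr X_ theta_ psi_.
Variable z : X * Theta * Psi.

Let measurable_chain t :
  measurable_fun setT (fun w => (X_ t w, theta_ t w, psi_ t w)).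
Proof. by have [[]] := chain. Qed.

Lemma measurable_state t : measurable_fun setT (X_ t).
Proof.
apply: (measurableT_comp _ (measurable_chain t)
  (f := fun u : X * Theta * Psi => u.1.1)).
exact: measurableT_comp.
Qed.

Lemma measurable_parameter t : measurable_fun setT (theta_ t).
Proof.
apply: (measurableT_comp _ (measurable_chain t)
  (f := fun u : X * Theta * Psi => u.1.2)).
exact: measurableT_comp.
Qed.

Lemma measurable_state_set (A : set X) : measurable A ->
  measurable [set u : X * Theta * Psi | A u.1.1].
Proof.
move=> mA; rewrite -[X in measurable X]setTI.
have : measurable_fun setT (fun u : X * Theta * Psi => u.1.1).
  exact: measurableT_comp.
by move=> /(_ measurableT A mA).
Qed.

Lemma measurable_parameter_set (A : set Theta) : measurable A ->
  measurable [set u : X * Theta * Psi | A u.1.2].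
Proof.
move=> mA; rewrite -[X in measurable X]setTI.
have : measurable_fun setT (fun u : X * Theta * Psi => u.1.2).
  exact: measurableT_comp.
by move=> /(_ measurableT A mA).
Qed.

Definition joint_kernel (u : Theta * X) : {measure set X -> \bar R} :=
  P u.1 u.2.

(** Joint measurability in the parameter and the state comes from [Q], whose first marginal is [P];
    the auxiliary variable is frozen at that of [z]. *)
Lemma measurable_joint_kernel A : measurable A ->
  measurable_fun setT (joint_kernel ^~ A).
Proof.
move=> mA; have [_ QP] := chain.
rewrite [X in measurable_fun _ X](_ : _ = (fun v : X * Theta * Psi => Q v [set u | A u.1.1]) \o
    (fun u : Theta * X => (u.2, u.1, z.2))); last first.
  by apply/funext => u /=; rewrite QP.
apply: measurableT_comp; first by apply: measurable_kernel; exact: measurable_state_set.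
apply: measurable_fun_pair => //.
by apply: measurable_fun_pair; [exact: measurable_snd|exact: measurable_fst].
Qed.

Lemma joint_kernel1 u : joint_kernel u setT = 1.
Proof. exact: prob_kernel. Qed.

Lemma measurable_joint_kpow t A : measurable A ->
  measurable_fun setT (fun u : Theta * X => kpow (P u.1) t u.2 A).
Proof.
move=> mA; elim: t => [|t ih].
  rewrite (_ : (fun _ => _) = (fun y : X => (\1_A y)%:E) \o snd)//.
  by apply: measurableT_comp => //; apply/measurable_EFinP.
apply: (measurable_fun_integral_finite_kernel
  (fun v : (Theta * X) * X => kpow (P v.1.1) t v.2 A)
  (pker_of measurable_joint_kernel joint_kernel1)).
  by move=> v; exact: measure_ge0.
apply: (measurableT_comp ih (f := fun u : Theta * X => kpow (P u.1) t u.2 A)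
  (g := fun v : (Theta * X) * X => (v.1.1, v.2))).
apply: measurable_fun_pair => //; exact: measurableT_comp.
Qed.

Lemma measurable_path_kpow s t n A : measurable A ->
  measurable_fun setT (fun w => kpow (P (theta_ s w)) n (X_ t w) A).
Proof.
move=> mA; apply: (measurableT_comp (measurable_joint_kpow n mA)
  (g := fun w => (theta_ s w, X_ t w))).
by apply: measurable_fun_pair; [exact: measurable_parameter|exact: measurable_state].
Qed.

Lemma measurable_path_kernel s A : measurable A ->
  measurable_fun setT (fun w => P (theta_ s w) (X_ s w) A).
Proof.
move=> mA; rewrite [X in measurable_fun _ X](_ : _ =
    (fun w => kpow (P (theta_ s w)) 1 (X_ s w) A)).
  exact: measurable_path_kpow.
by apply/funext => w; rewrite kpow1.
Qed.

(** Both sides are integrals of [h] against finite measures on [Theta * X]. These agree on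
    rectangles by the Markov property, as [theta_ r] belongs to the history up to [s >= r], and
    rectangles form a generating class closed under intersection. *)
Lemma joint_law r s (h : Theta * X -> \bar R) : (r <= s)%N ->
  measurable_fun setT h -> (forall u, 0 <= h u) ->
  \int[Pr z]_w h (theta_ r w, X_ s.+1 w) =
  \int[Pr z]_w \int[P (theta_ s w) (X_ s w)]_y h (theta_ r w, y).
Proof.
move=> rs mh h0.
(* Both measures are written as compositions of kernels issued from the one-point type, starting
   with [Pr z], so that [integral_kcomp] computes their integrals. *)
pose l0 := kprobability (@measurable_cst _ _ unit _ setT
  (Pr z : pprobability Omega R)).
have mtX t : measurable_fun setT (fun v : unit * Omega =>
    (theta_ r v.2, X_ t v.2)).
  apply: (measurableT_comp (f := fun w => (theta_ r w, X_ t w))) => //.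
  by apply: measurable_fun_pair; [exact: measurable_parameter|exact: measurable_state].
pose k1 := kdirac (R := R) (mtX s.+1).
have mK A : measurable A -> measurable_fun setT (fun v : unit * Omega =>
    P (theta_ s v.2) (X_ s v.2) A).
  move=> mA; apply: (measurableT_comp
    (f := fun w => P (theta_ s w) (X_ s w) A)) => //.
  exact: measurable_path_kernel.
pose l1 := pker_of mK (fun v => @prob_kernel _ _ _ _ _ (P (theta_ s v.2)) (X_ s v.2)).
have mpair : measurable_fun setT (fun v : (unit * Omega) * X =>
    (theta_ r v.1.2, v.2)).
  apply: measurable_fun_pair => //.
  apply: (measurableT_comp (measurable_parameter r)).
  exact: measurableT_comp.
pose k2 := kdirac (R := R) mpair.
have E1 g : measurable_fun setT g -> (forall u, 0 <= g u) ->
    \int[mkcomp l0 k1 tt]_u g u = \int[Pr z]_w g (theta_ r w, X_ s.+1 w).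
  move=> mg g0; rewrite (integral_kcomp l0 k1 tt g0 mg).
  by apply: eq_integral => w _; rewrite integral_dirac// diracT mul1e.
have E2 g : measurable_fun setT g -> (forall u, 0 <= g u) ->
    \int[mkcomp l0 (mkcomp l1 k2) tt]_u g u =
    \int[Pr z]_w \int[P (theta_ s w) (X_ s w)]_y g (theta_ r w, y).
  move=> mg g0; rewrite (integral_kcomp l0 (mkcomp l1 k2) tt g0 mg).
  apply: eq_integral => w _; rewrite (integral_kcomp l1 k2 (tt, w) g0 mg).
  by apply: eq_integral => y _; rewrite integral_dirac// diracT mul1e.
rewrite -E1// -E2//; apply: eq_measure_integral => E mE _.
pose G := [set C | exists F A, [/\ measurable (F : set Theta),
  measurable (A : set X) & C = F `*` A]].
have mX1 : measurable_fun setT (X_ s.+1) by exact: measurable_state.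
have mth : measurable_fun setT (theta_ r) by exact: measurable_parameter.
have rect C : G C -> mkcomp l0 k1 tt C = mkcomp l0 (mkcomp l1 k2) tt C.
  move=> [F [A [mF mA ->]]].
  have mFA : measurable (F `*` A) by exact: measurableX.
  have m1FA : measurable_fun setT (fun u => (\1_(F `*` A) u)%:E : \bar R).
    by apply/measurable_EFinP; exact: measurable_indic.
  rewrite -[LHS]integral_indicT// -[RHS]integral_indicT//.
  rewrite E1// E2//.
  have mrF : measurable (theta_ r @^-1` F) by rewrite -[X in measurable X]setTI; exact: mth.
  have mXA : measurable (X_ s.+1 @^-1` A) by rewrite -[X in measurable X]setTI; exact: mX1.
  transitivity (Pr z (theta_ r @^-1` F `&` X_ s.+1 @^-1` A)).
    rewrite -[RHS]integral_indicT//; last exact: measurableI.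
  have [[_ _ markov] QP] := chain.
  have mrF' : history (fun t w => (X_ t w, theta_ t w, psi_ t w)) s (theta_ r @^-1` F).
    apply: sub_sigma_algebra; exists r => //.
    exists [set u | F u.1.2]; first exact: measurable_parameter_set.
    by rewrite setTI.
  have := markov z s _ _ mrF' (measurable_state_set mA).
  rewrite (_ : _ @^-1` [set u | A u.1.1] = X_ s.+1 @^-1` A)// => ->.
  rewrite integral_mkcond; apply: eq_integral => w _.
  rewrite patchE QP//; case: ifPn => [/set_mem wF|/negP wF].
    rewrite -[LHS]integral_indicT//; apply: eq_integral => y _.
    rewrite !indicE (_ : ((theta_ r w, y) \in F `*` A) = (y \in A))//.
    by apply/idP/idP; rewrite !inE//= => -[].
  rewrite integral0_eq// => y _; rewrite indicE memNset// => -[/= Fw _].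
  by apply: wF; rewrite inE.
apply: (measure_unique G (fun=> setT)) mE => //.
- rewrite measurable_prod_measurableType //; congr (<<s _ >>).
  rewrite predeqE; split => [[A mA [C mC <-]]|[A [C [mA mC ->]]]].
    by exists A, C.
  by exists A => //; exists C.
- move=> _ _ [A1 [A2 [mA1 mA2 ->]]] [C1 [C2 [mC1 mC2 ->]]].
  rewrite -setXI; exists (A1 `&` C1), (A2 `&` C2).
  by split=> //; exact: measurableI.
- by move=> _; exists setT, setT; split => //; rewrite setXTT.
- by apply/seteqP; split => // u _; exists 0%N.
- move=> _; have := E1 (cst 1) (measurable_cst _) (fun=> lee01).
  by rewrite !integral_cst// !mul1e => ->; rewrite [X in X < _]probability_setT ltry.
Qed.

(** The step made at time [s] with [theta_ s] is replaced by a step with [theta_ r], at cost [e] off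
    [D] and at most 1 on [D]. *)
Lemma one_step_approx r s n A D e c : (r <= s)%N -> measurable A ->
  measurable D -> Pr z D <= c%:E -> (0 <= e)%R ->
  (forall w, ~ D w -> forall A', measurable A' ->
    P (theta_ s w) (X_ s w) A' <= P (theta_ r w) (X_ s w) A' + e%:E) ->
  \int[Pr z]_w kpow (P (theta_ r w)) n (X_ s.+1 w) A <=
  \int[Pr z]_w kpow (P (theta_ r w)) n.+1 (X_ s w) A + (e + c)%:E.
Proof.
move=> rs mA mD Dc e0 H.
have mh := measurable_joint_kpow n mA.
rewrite (joint_law rs mh); last by move=> u; exact: measure_ge0.
have mk theta : measurable_fun setT (fun y => kpow (P theta) n y A).
  exact: measurable_kernel.
have k01 theta y : 0 <= kpow (P theta) n y A <= 1 by exact: kpow_le1.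
apply: (le_integral_off_event _ _ _ _ e0 mD Dc).
- apply: (measurable_fun_integral_finite_kernel
    (fun v : Omega * X => kpow (P (theta_ r v.1)) n v.2 A)
    (pker_of (measurable_path_kernel s)
      (fun w => @prob_kernel _ _ _ _ _ (P (theta_ s w)) (X_ s w)))).
    by move=> v; exact: measure_ge0.
  apply: (measurableT_comp mh (g := fun v : Omega * X => (theta_ r v.1, v.2))).
  apply: measurable_fun_pair => //.
  exact: (measurableT_comp (measurable_parameter r)).
- exact: measurable_path_kpow.
- move=> w; rewrite integral_ge0//=.
  apply: (@le_trans _ _ (\int[P (theta_ s w) (X_ s w)]_y cst 1 y)).
    apply: ge0_le_integral => // y _.
    by have /andP[] := k01 (theta_ r w) y.
  by rewrite integral_cst// mul1e prob_kernel.
- by move=> w; exact: measure_ge0.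
- move=> w nDw; exact: (le_integral_approx_measure (prob_kernel_ltoo _ _)
    (prob_kernel_ltoo _ _) (H w nDw) (mk _) (k01 _)).
Qed.

(** Induction on the number of true steps: the last one becomes a frozen step, so [n] grows as [N]
    decreases. *)
Lemma telescoping_approx r N n A (D : nat -> set Omega) e c : measurable A ->
  (0 <= e)%R -> (forall i, (i < N)%N -> measurable (D i) /\ Pr z (D i) <= c%:E) ->
  (forall i w, (i < N)%N -> ~ D i w -> forall A', measurable A' ->
    P (theta_ (r + i) w) (X_ (r + i) w) A' <=
    P (theta_ r w) (X_ (r + i) w) A' + e%:E) ->
  \int[Pr z]_w kpow (P (theta_ r w)) n (X_ (r + N) w) A <=
  \int[Pr z]_w kpow (P (theta_ r w)) (n + N) (X_ r w) A +
    (N%:R * (e + c))%:E.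
Proof.
move=> mA e0; elim: N n => [|N ih] n HD H.
  by rewrite !addn0 mul0r adde0.
rewrite addnS; have [mD Dc] := HD N (ltnSn N).
have rN := leq_addr N r.
have := one_step_approx n rN mA mD Dc e0 (fun w => H N w (ltnSn N)).
move=> /le_trans; apply.
have := ih n.+1 (fun i iN => HD i (ltnW iN)) (fun i w iN => H i w (ltnW iN)).
move=> /(leeD2r (e + c)%:E) /le_trans; apply.
by rewrite -addeA -EFinD addSnnS -addn1 natrD mulrDl mul1r.
Qed.

End adaptive_chain.

(** * Convergence of the adaptive chain *)

Section convergence.
Context (R : realType) (dX dT dP dO : measure_display)
  (X : metricMeasurableType dX R) (Theta : metricMeasurableType dT R)
  (Psi : measurableType dP) (Omega : measurableType dO)
  (pi : probability X R) (P : Theta -> R.-pker X ~> X)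
  (Q : R.-pker (X * Theta * Psi)%type ~> (X * Theta * Psi)%type)
  (Pr : X * Theta * Psi -> probability Omega R)
  (X_ : nat -> Omega -> X) (theta_ : nat -> Omega -> Theta)
  (psi_ : nat -> Omega -> Psi).
Hypothesis chain : adaptive_mcmc P Q Pr X_ theta_ psi_.
Variable z : X * Theta * Psi.
Hypothesis tight : forall delta : R, (0 < delta)%R ->
  exists C : set (X * Theta), compact C /\
    forall t, measurable [set w | C (X_ t w, theta_ t w)] /\
      (1 - delta)%:E <= Pr z [set w | C (X_ t w, theta_ t w)].
Hypothesis diminishing : cvg0_in_probability (Pr z)
  (fun t w => mdist (theta_ t.+1 w) (theta_ t w)).
Hypothesis uniform : forall (C : set (X * Theta)) (e : R), compact C ->
  (0 < e)%R -> exists n, forall x theta, C (x, theta) ->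
  forall A, measurable A -> kpow (P theta) n x A <= pi A + e%:E.
Hypothesis equicontinuous : forall (C : set (X * Theta)) (e : R), compact C ->
  (0 < e)%R -> exists2 eta : R, (0 < eta)%R & forall x theta theta',
    C (x, theta) -> (mdist theta theta' < eta)%R ->
    forall A, measurable A -> P theta x A <= P theta' x A + e%:E.

Lemma outside_le (E : set Omega) (c : R) : measurable E ->
  (1 - c)%:E <= Pr z E -> Pr z (~` E) <= c%:E.
Proof.
move=> mE; rewrite probability_setC// -(fineK (fin_num_measure (Pr z) E mE)).
rewrite -EFinB !lee_fin; lra.
Qed.

Lemma parameter_drift t n w (r : R) :
  (forall m, (m < n)%N ->
    (mdist (theta_ (t + m).+1 w) (theta_ (t + m) w) <= r)%R) ->
  (mdist (theta_ (t + n) w) (theta_ t w) <= n%:R * r)%R.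
Proof.
elim: n => [|n ih] H; first by rewrite addn0 mdistxx mul0r.
apply: (le_trans (metric_triangle _ (theta_ (t + n) w) _)).
rewrite addnS -natr1 mulrDl mul1r addrC.
by apply: lerD; [apply: ih => m mn; apply: H; exact: ltnW|exact: H].
Qed.

Lemma diminishing_le (eta c : R) : (0 < eta)%R -> (0 < c)%R ->
  exists T, forall t, (T <= t)%N ->
  Pr z [set w | (eta < `|mdist (theta_ t.+1 w) (theta_ t w)|)%R] <= c%:E.
Proof.
move=> eta0 c0; have [_ /(_ eta eta0)] := diminishing.
move=> /fine_cvgP[fin /cvgrPdist_lt/(_ c c0)].
move=> /(filterI fin)[T _ HT]; exists T => t /HT[/= tfin].
rewrite sub0r normrN -lte_fin => tc.
by rewrite -(fineK tfin) lee_fin (le_trans (ler_norm _))// ltW// -lte_fin.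
Qed.

(** The chain is compared from time [t = t' - N] on with the kernel frozen at [theta_ t]. Uniform
    closeness on [C] costs [e / 4], starting outside [C] another [e / 4], and the [N] replacements
    at most [e / 2]. *)
Lemma law_le (e : R) : (0 < e)%R -> exists T, forall t, (T <= t)%N ->
  forall A, measurable A -> Pr z (X_ t @^-1` A) <= pi A + e%:E.
Proof.
move=> e0; have e40 : (0 < e / 4)%R by rewrite divr_gt0.
have [C [cC HC]] := tight e40; have [N HN] := uniform cC e40.
(* A positive divisor even when [N] is 0, and strictly above [N]. *)
pose M : R := N.+1%:R; have M0 : (0 < M)%R by rewrite ltr0n.
have NM : (N%:R < M)%R by rewrite ltr_nat.
pose c : R := (e / 4 / M)%R; have c0 : (0 < c)%R by rewrite divr_gt0.
have c20 : (0 < c / 2)%R by rewrite divr_gt0.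
(* This second compact set is chosen after [N], since leaving it is paid for at each of the [N]
   steps. *)
have [C' [cC' HC']] := tight c20; have [eta eta0 Heta] := equicontinuous cC' c0.
have etaM0 : (0 < eta / M)%R by rewrite divr_gt0.
have cM0 : (0 < c / 2 / M)%R by rewrite divr_gt0.
have [T HT] := diminishing_le etaM0 cM0.
exists (T + N)%N => t' Tt' A mA.
have [t [tT ->]] : exists t, (T <= t)%N /\ t' = (t + N)%N.
  exists (t' - N)%N; split; first by rewrite leq_subRL ?(leq_trans _ Tt') ?leq_addl// addnC.
  by rewrite subnK// (leq_trans _ Tt')// leq_addl.
(* A large parameter jump at step [t + m]; outside the union [U] of these events, the drift over
   fewer than [N] steps stays below [eta]. *)
pose J m := [set w | (eta / M < `|mdist (theta_ (t + m).+1 w) (theta_ (t + m) w)|)%R].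
have mJ m : measurable (J m).
  have [/(_ (t + m)%N) md _] := diminishing.
  have mn : measurable_fun setT
      (fun w => `|mdist (theta_ (t + m).+1 w) (theta_ (t + m) w)|%R).
    exact: measurableT_comp.
  rewrite (_ : J m = setT `&` (fun w => `|mdist (theta_ (t + m).+1 w)
    (theta_ (t + m) w)|%R) @^-1` `](eta / M)%R, +oo[); first exact: mn.
  by rewrite setTI; apply/seteqP; split => w /=; rewrite in_itv/= andbT.
pose U := \big[setU/set0]_(m < N) J m.
have mU : measurable U by apply: bigsetU_measurable.
have U_le : Pr z U <= (c / 2)%:E.
  apply: (le_trans (Boole_inequality _ _)) => [m _|]; first exact: mJ.
  apply: (@le_trans _ _ (\sum_(m < N) (c / 2 / M)%:E)).
    by apply: lee_sum => m _; apply: HT; rewrite (leq_trans tT)// leq_addr.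
  rewrite sumEFin lee_fin sumr_const card_ord -[leLHS]mulr_natr mulrAC.
  by rewrite ler_pdivrMr// ler_pM2l// ltW.
pose V i := [set w | C' (X_ (t + i) w, theta_ (t + i) w)].
have mV i : measurable (V i) by have [] := HC' (t + i)%N.
have V_le i : Pr z (~` V i) <= (c / 2)%:E.
  by apply: outside_le => //; have [] := HC' (t + i)%N.
have mPX s : measurable (X_ s @^-1` A).
  rewrite -[X in measurable X]setTI.
  exact: (measurable_state chain s measurableT mA).
(* Zero frozen steps give a Dirac mass, which starts the telescoping at [n = 0]. *)
have start : Pr z (X_ (t + N) @^-1` A) =
    \int[Pr z]_w kpow (P (theta_ t w)) 0 (X_ (t + N) w) A.
  by rewrite -[LHS]integral_indicT.
have := @telescoping_approx _ _ _ _ _ _ _ _ _ _ _ _ _ _ _ chain z t N 0 A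
  (fun i => ~` V i `|` U) c c mA (ltW c0).
rewrite add0n -start => step; apply: (le_trans (step _ _)).
- move=> i iN; split; first by apply: measurableU => //; exact: measurableC.
  apply: (le_trans (measureU2 _ _ _)) => //; first exact: measurableC.
  by rewrite [in leRHS](splitr c) EFinD; apply: leeD; [exact: V_le|exact: U_le].
- move=> i w iN /not_orP[/contrapT Vw nU] A' mA'.
  apply: Heta Vw _ _ mA'.
  apply: (@le_lt_trans _ _ (i%:R * (eta / M))%R).
    apply: parameter_drift => m mi; rewrite leNgt; apply/negP => Jm.
    apply: nU; rewrite /U -bigcup_mkord; exists m; first exact: ltn_trans iN.
    by rewrite /J /= (lt_le_trans Jm)// ler_norm.
  rewrite mulrCA gtr_pMr// ltr_pdivrMr// mul1r (lt_trans _ NM)//.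
  by rewrite ltr_nat.
have N_le : \int[Pr z]_w kpow (P (theta_ t w)) N (X_ t w) A <=
    \int[Pr z]_w cst (pi A) w + (e / 4 + e / 4)%:E.
  have [mC Cge] := HC t.
  apply: (le_integral_off_event _ _ _ _ (ltW e40) (measurableC mC)
    (outside_le mC Cge)).
  - exact: (measurable_path_kpow chain z).
  - exact: measurable_cst.
  - by move=> w; exact: kpow_le1.
  - by move=> w; exact: measure_ge0.
  - by move=> w /contrapT Cw; exact: HN.
rewrite integral_cst// [X in _ * X]probability_setT mule1 in N_le.
apply: (le_trans (leeD2r _ N_le)); rewrite -addeA -EFinD; apply: leeD2l.
rewrite lee_fin; have : (N%:R * (c + c) <= M * (c + c))%R.
  by rewrite ler_pM2r ?ltW// addr_gt0.
have -> : (M * (c + c) = e / 4 + e / 4)%R.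
  by rewrite mulrDr /c mulrCA divff ?mulr1// gt_eqF.
lra.
Qed.

Lemma law_cvg :
  tv_norm (fun A => Pr z (X_ t @^-1` A) - pi A) @[t --> \oo] --> 0.
Proof.
pose v t := tv_norm (fun A => Pr z (X_ t @^-1` A) - pi A).
have v0 t : 0 <= v t.
  apply: (le_trans (abse_ge0 (Pr z (X_ t @^-1` set0) - pi set0))).
  by apply: ereal_sup_ubound; exists set0.
have mPX s A : measurable A -> measurable (X_ s @^-1` A).
  by move=> mA; rewrite -[X in measurable X]setTI;
  exact: (measurable_state chain s measurableT mA).
(* This bound also gives the eventual finiteness of [v t] required for convergence in the extended
   reals. *)
have ve (e : R) : (0 < e)%R -> \forall t \near \oo, v t <= e%:E.
  move=> e0; have [T HT] := law_le e0; exists T => // t /= Tt.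
  apply: ge_ereal_sup => _ [A mA <-].
  have le1 := HT t Tt A mA.
  have le2 : pi A <= Pr z (X_ t @^-1` A) + e%:E.
    move: A mA {le1}; apply: (@le_approx_setC _ _ _
      (fun A => Pr z (X_ t @^-1` A)) pi e _ _ _ _ (HT t Tt)) => A mA //.
    - rewrite preimage_setC; apply: (measure1C (mu := Pr z)).
        exact: probability_setT.
      exact: mPX.
    - by apply: measure1C => //; exact: probability_setT.
  move: le1 le2; rewrite -(fineK (fin_num_measure (Pr z) _ (mPX t A mA))).
  rewrite -(fineK (fin_num_measure pi _ mA)) -EFinB -!EFinD !lee_fin ler_norml.
  move=> le1 le2; apply/andP; split; lra.
have vfin t (e : R) : v t <= e%:E -> v t \is a fin_num.
  by move=> vt; rewrite ge0_fin_numE ?v0//; exact: le_lt_trans vt (ltry _).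
apply/fine_cvgP; split; first by apply: filterS (ve 1%R ltr01) => t; exact: vfin.
apply/cvgrPdist_le => e e0; apply: filterS (ve e e0) => t vt.
have vte : (fine (v t) <= e)%R by rewrite -lee_fin fineK// (vfin _ _ vt).
by rewrite sub0r normrN ger0_norm; [exact: vte|exact: fine_ge0 (v0 t)].
Qed.

End convergence.

(** * Assembly of the two cases *)

Unset Implicit Arguments.

Theorem theorem1 (R : realType) (dX dT dP dO : measure_display)
    (X : metricMeasurableType dX R) (Theta : metricMeasurableType dT R)
    (Psi : measurableType dP) (Omega : measurableType dO)
    (lambda : {measure set X -> \bar R})
    (pi : probability X R) (g_pi : X -> R)
    (pi_density : has_density lambda pi g_pi)
    (P : Theta -> R.-pker X ~> X)
    (Ptilde B : nat -> Theta -> X -> {measure set X -> \bar R})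
    (ptilde : nat -> Theta -> X -> X -> R)
    (P_decomposition : forall t theta x, (1 <= t)%N ->
      lebesgue_decomposition lambda (kernel_iter (P theta) t x)
        (Ptilde t theta x) (B t theta x) /\
      has_density lambda (Ptilde t theta x) (ptilde t theta x))
    (Q : R.-pker (X * Theta * Psi)%type ~> (X * Theta * Psi)%type)
    (Pr : X * Theta * Psi -> probability Omega R)
    (X_ : nat -> Omega -> X) (theta_ : nat -> Omega -> Theta)
    (psi_ : nat -> Omega -> Psi)
    (chain : adaptive_mcmc P Q Pr X_ theta_ psi_)
    (cond_i : forall z (delta : R), (0 < delta)%R ->
      exists C : set (X * Theta), compact C /\
        forall t, measurable [set w | C (X_ t w, theta_ t w)] /\
          (1 - delta)%:E <= Pr z [set w | C (X_ t w, theta_ t w)])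
    (cond_ii : forall z,
      cvg0_in_probability (Pr z)
        (fun t w => mdist (theta_ t.+1 w) (theta_ t w)))
    (cond_iii : forall theta x,
      tv_norm (fun A => kernel_iter (P theta) t x A - pi A)
        @[t --> \oo] --> 0)
    (cond_I_or_II :
      ((forall t, (1 <= t)%N ->
          continuous (fun v : X * Theta * X => ptilde t v.1.2 v.1.1 v.2) /\
          continuous (fun u : X * Theta => Ptilde t u.2 u.1 setT)) /\
       exists (I : countType) (b : I -> X * Theta -> R) (s : I -> X -> X),
         atomic_decomposition (B 1%N) b s)
      \/
      [/\ continuous (fun v : X * Theta * X => ptilde 1%N v.1.2 v.1.1 v.2),
          continuous (fun u : X * Theta => Ptilde 1%N u.2 u.1 setT),
          forall (theta0 : Theta) (y0 : X),
            exists (U : set (Theta * X)) (M : R), nbhs (theta0, y0) U /\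
              forall x theta y, U (theta, y) -> (ptilde 1%N theta x y < M)%R &
          exists (I : countType) (b : I -> X * Theta -> R) (s : I -> X -> X),
            atomic_decomposition (B 1%N) b s /\
            forall i, (exists a, forall x, s i x = a) \/
                      (forall x, s i x = x)]) :
  forall z : X * Theta * Psi,
    tv_norm (fun A => Pr z (X_ t @^-1` A) - pi A) @[t --> \oo] --> 0.
Proof.
move=> z.
have pi_dom N : measurable N -> lambda N = 0 -> pi N = 0.
  move=> mN lN; have [mg g0 ->//] := pi_density.
  by apply: null_set_integral => //; exact/measurable_funTS/measurable_EFinP.
have [I [b [s atomic]]] : exists (I : countType) (b : I -> X * Theta -> R)
    (s : I -> X -> X), atomic_decomposition (B 1%N) b s.
  case: cond_I_or_II => [[_ ?] //|[_ _ _ [I [b [s [atomic _]]]]]].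
  by exists I, b, s.
have c1 : ptilde_continuous ptilde 1.
  by case: cond_I_or_II => [[/(_ 1%N isT)[]]|[]].
(* Equicontinuity comes first; it rests on the one-step density and the atoms, which both cases
   provide. Only the uniform closeness distinguishes the cases. *)
apply: (law_cvg chain (cond_i z) (cond_ii z)) => C e cC e0; last first.
  exact: (kernel_equicontinuous P_decomposition atomic c1 cC e0).
apply: (uniform_close cond_iii cC) => p.
case: cond_I_or_II => [[ct _]|[_ _ _ [I' [b' [s' [atomic' cst_or_id]]]]]].
- apply: (near_close_continuous_density pi_dom P_decomposition) => // t t1.
  by have [] := ct t t1.
- exact: (near_close_constant_or_identity pi_dom P_decomposition cond_iii
    atomic' c1 cst_or_id).
Qed.
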